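(* Let $0\le\alpha<2$ and $\beta,\mu\in\mathbb R$ with $\Delta=(1-\alpha-\beta)^2-4\mu\ge0$. If $T>\frac{4}{2-\alpha}$, then there exists $c_T>0$ such that $$c_T\|(w_0,w_1)\|_X^2\le\int_0^T\left|\mathbb B_\nu^*\mathbb T(t)(w_0,w_1)\right|^2dt\qquad\text{for all }(w_0,w_1)\in X_1 .$$
   Context: Parameters: $\kappa_\alpha=\frac{2-\alpha}{2}$, $\Delta=(1-\alpha-\beta)^2-4\mu$, $\nu=\frac{\sqrt\Delta}{2\kappa_\alpha}$, $\sigma=\frac{1-\alpha-\beta}{2}$. Spectral data: $J_\nu$ is the Bessel function of the first kind, $0<j_{\nu,1}<j_{\nu,2}<\dots$ its positive zeros. For $k\ge1$ put $$\Phi_k(x)=\frac{(2\kappa_\alpha)^{1/2}}{|J_\nu'(j_{\nu,k})|}x^\sigma J_\nu(j_{\nu,k}x^{\kappa_\alpha}),\qquad \lambda_k=\kappa_\alpha^2 j_{\nu,k}^2 .$$ $(\Phi_k)_{k\ge1}$ is an orthonormal basis of the complex Hilbert space $L^2_\beta(0,1)=L^2((0,1);x^\beta dx)$. Fractional spaces: for $s\in\mathbb R$, $\mathcal H^s$ is the Hilbert space of (formal, if $s<0$) series $u=\sum_{k\ge1}a_k\Phi_k$, $a_k\in\mathbb C$, with $\|u\|_{\mathcal H^s}^2=\sum_k\lambda_k^s|a_k|^2<\infty$. The operator $\mathcal A:\mathcal H^{s+2}\to\mathcal H^s$ acts by $\mathcal A\sum a_k\Phi_k=\sum\lambda_k a_k\Phi_k$.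 State spaces: $X=\mathcal H^{\nu+1/2}\times\mathcal H^{\nu-1/2}$ and $X_1=\mathcal H^{\nu+3/2}\times\mathcal H^{\nu+1/2}$ with the product Hilbert norms. The operator $\mathbf A(w_0,w_1)=(w_1,-\mathcal A w_0)$ with domain $X_1$ is skew-adjoint on $X$ and generates a unitary group $\mathbb T(t)$, $t\in\mathbb R$, which preserves $X_1$; explicitly, if $w_0=\sum a_k\Phi_k$, $w_1=\sum c_k\Phi_k$ and $\gamma_k=\lambda_k^{1/2}$, then the first component of $\mathbb T(t)(w_0,w_1)$ is $\sum_k(a_k\cos\gamma_kt+\gamma_k^{-1}c_k\sin\gamma_kt)\Phi_k$ and the second is its time derivative. Observation operator $\mathbb B_\nu^*:X_1\to\mathbb C$ (a bounded linear functional): $\mathbb B_\nu^*(w_0,w_1)=\lim_{x\to0^+}x^{-\sigma}w_0(x)$ if $\nu=0$, and $\mathbb B_\nu^*(w_0,w_1)=\sqrt\Delta\lim_{x\to0^+}x^{-\sigma-\sqrt\Delta/2}w_0(x)$ if $\nu>0$, where $w_0$ is identified with its continuous representative on $(0,1)$. *)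

(* Defs.v *)
(* MathComp / MathComp-Analysis, over an abstract [R : realType]; complex
   numbers are [R[i]] from mathcomp-real-closed.  Sequences indexed by
   k = 1, 2, ... in the mathematics are indexed here by [k : nat] from 0, so
   [bessel_zero nu k] is j_{nu,k+1}, [Phi _ _ _ k] is Phi_{k+1}, etc. *)
From HB Require Import structures.
From mathcomp Require Import all_boot all_order all_algebra.
From mathcomp Require Import complex.
From mathcomp Require Import all_classical all_reals all_analysis.

Set Implicit Arguments.
Unset Strict Implicit.
Unset Printing Implicit Defensive.

Import Order.TTheory GRing.Theory Num.Theory.
Import numFieldTopology.Exports numFieldNormedType.Exports.

Local Open Scope classical_set_scope.
Local Open Scope ring_scope.

Section Bessel.
Variable R : realType.
Implicit Types (nu x : R) (k m : nat).

(* Euler's integral; only used for s > 0. *)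
Definition Gamma (s : R) : R :=
  \int[lebesgue_measure]_(t in `]0, +oo[) (t `^ (s - 1) * expR (- t)).

(* Power series of J_nu, for nu >= 0 and x > 0. *)
Definition besselJ nu x : R :=
  limn (series (fun m => (-1) ^+ m / (m`!%:R * Gamma (m%:R + nu + 1))
                         * (x / 2) `^ ((2 * m)%:R + nu))).

(* The positive zeros in increasing order: they form a discrete set with no
   accumulation point in [0, +oo[, hence each infimum is attained. *)
Fixpoint bessel_zero nu k : R :=
  inf [set x | (if k is k'.+1 then bessel_zero nu k' else 0) < x
               /\ besselJ nu x = 0].

End Bessel.

Section Spectral.
Variables (R : realType) (alpha beta mu : R).

Definition kappa : R := (2 - alpha) / 2.
Definition Delta : R := (1 - alpha - beta) ^+ 2 - 4 * mu.
Definition nu : R := Num.sqrt Delta / (2 * kappa).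
Definition sigma : R := (1 - alpha - beta) / 2.

Definition Phi (k : nat) (x : R) : R :=
  Num.sqrt (2 * kappa) / `| derive1 (besselJ nu) (bessel_zero nu k) |
  * x `^ sigma * besselJ nu (bessel_zero nu k * x `^ kappa).

Definition lambda (k : nat) : R := kappa ^+ 2 * bessel_zero nu k ^+ 2.
Definition gamma (k : nat) : R := Num.sqrt (lambda k).

(* A formal series \sum_k a_k Phi_k is represented by its coefficients. *)
Definition coefs := nat -> R[i].

(* The squared H^s norm, with value +oo outside H^s. *)
Definition Hnorm2 (s : R) (a : coefs) : \bar R :=
  (\sum_(0 <= k <oo) (lambda k `^ s * ComplexField.Normc.normc (a k) ^+ 2)%:E)%E.

Definition in_H (s : R) (a : coefs) : Prop := (Hnorm2 s a < +oo)%E.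

Definition in_X1 (w : coefs * coefs) : Prop :=
  in_H (nu + 3 / 2) w.1 /\ in_H (nu + 1 / 2) w.2.

Definition Xnorm2 (w : coefs * coefs) : \bar R :=
  (Hnorm2 (nu + 1 / 2) w.1 + Hnorm2 (nu - 1 / 2) w.2)%E.

(* The group generated by (w_0, w_1) |-> (w_1, - A w_0): each mode solves
   a_k'' = - lambda_k a_k, and the second component is the time derivative. *)
Definition evolution (t : R) (w : coefs * coefs) : coefs * coefs :=
  (fun k => w.1 k * (cos (gamma k * t))%:C%C
            + w.2 k * ((gamma k)^-1 * sin (gamma k * t))%:C%C,
   fun k => w.2 k * (cos (gamma k * t))%:C%C
            - w.1 k * (gamma k * sin (gamma k * t))%:C%C).

(* f is the sum of \sum_k a_k Phi_k in L^2((0,1); x^beta dx). *)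
Definition is_L2_sum (a : coefs) (f : R -> R[i]) : Prop :=
  (fun n => \int[lebesgue_measure]_(x in `]0%R, 1%R[)
     (ComplexField.Normc.normc (f x - \sum_(0 <= k < n) a k * (Phi k x)%:C%C) ^+ 2
      * x `^ beta)%:E)%E @ \oo --> 0%E.

(* The function chosen is determined on (0,1) only. *)
Definition continuous_representative (a : coefs) : R -> R[i] :=
  xget (fun=> 0) [set f : R -> R[i] |
    {within `]0%R, 1%R[, continuous (f : R -> R[i]^o)} /\ is_L2_sum a f].


Definition weighted_limit0 (p : R) (w : R -> R[i]) : R[i] :=
  lim ((fun x : R => (x `^ p)%:C%C * w x : R[i]^o) @ 0^'+).

Definition observation (w : coefs * coefs) : R[i] :=
  let w0 := continuous_representative w.1 in
  if nu == 0 then weighted_limit0 (- sigma) w0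
  else (Num.sqrt Delta)%:C%C
       * weighted_limit0 (- sigma - Num.sqrt Delta / 2) w0.

End Spectral.

(* Main.v *)
Require Import Defs.
From mathcomp Require Import all_boot all_order all_algebra.
From mathcomp Require Import complex.
From mathcomp Require Import all_classical all_reals all_analysis.
From mathcomp Require Import measurable_realfun.
From mathcomp Require Import ring lra.

Set Implicit Arguments.
Unset Strict Implicit.
Unset Printing Implicit Defensive.

Import Order.TTheory GRing.Theory Num.Theory.
Import numFieldTopology.Exports numFieldNormedType.Exports.

Local Open Scope classical_set_scope.
Local Open Scope ring_scope.

(** The trace of the solution at the origin is a trigonometric series in time,
    and its coefficients are bounded by its L2 norm over [[0, T]] by means of an
    inequality of Ingham type.

    _The trace._ Write [J_nu x = (x / 2)^nu G (x^2 / 4)] with [G] entire. Then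
    [Phi_k x = W_k x^(sigma + kappa nu) G (j_k^2 x^(2 kappa) / 4)], where
    [W_k] is a constant multiple of [j_k^nu / |J_nu' (j_k)|]. The limit defining
    the observation divides by this power of [x], so that it is a nonzero
    multiple of [\sum_k W_k a_k] ([observation_normc]), and the observed signal
    is a multiple of
    [y t = \sum_k W_k (a_k cos (gamma_k t) + v_k sin (gamma_k t))], where
    [v_k = c_k / gamma_k]. Membership in [X_1] makes the series converge
    absolutely ([in_X1_edge_summable]). As [W_k^2] is comparable with
    [gamma_k^(2 nu + 1)] ([mode_weight_bounds]), and the squared norm of [X] is
    [\sum_k gamma_k^(2 nu + 1) (|a_k|^2 + |v_k|^2)], what is to be shown is that
    the integral of [|y|^2] bounds the sum of the squares of the coefficients
    of [y]; real and imaginary parts are treated separately.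

    _The frequencies._ They are [gamma_k = kappa j_k]. The function
    [u x = sqrt x J_nu x] solves [u'' = - (1 + (1 / 4 - nu^2) / x^2) u], close to
    [u'' = - u] for large [x]. Sturm comparison shows that the zeros [j_k] are
    uniformly separated and that their gaps are eventually at least [pi / M], for
    each [M > 1] ([bessel_zero_asymptotic_gap]). The energy [u^2 + u'^2] varies
    by a bounded factor, which yields the bounds on [j_k J_nu' (j_k)^2] behind
    the comparison of weights ([bessel_zero_derive_bounds]).

    _The inequality._ If all gaps of the frequencies exceed [2 pi / T], testing
    [y^2] with a cosine weight on an interval of length [T] gives a diagonally
    dominant quadratic form ([ingham_kernel], [observable_gap]). Here the gaps
    are eventually at least [kappa pi / M], and [kappa pi > 2 pi / T] is the
    assumption on [T], so that some [M > 1] will do; only finitely many low modes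
    may violate the bound. They are added one at a time, each at the price of an
    arbitrarily small extension of the interval ([observable_extend], after
    Haraux). The inequality for partial sums passes to [y] by uniform
    convergence ([trigseries_observed]). *)

(** * Calculus of functions of one real variable *)

Section Calculus.
Variable R : realType.
Implicit Types (f g F : R -> R) (a b c x y : R).

Lemma is_derive_add f g x a b : is_derive x 1 f a -> is_derive x 1 g b ->
  is_derive x 1 (fun y => f y + g y) (a + b).
Proof. exact: is_deriveD. Qed.

Lemma is_derive_sub f g x a b : is_derive x 1 f a -> is_derive x 1 g b ->
  is_derive x 1 (fun y => f y - g y) (a - b).
Proof. exact: is_deriveB. Qed.

Lemma is_derive_opp f x a : is_derive x 1 f a ->
  is_derive x 1 (fun y => - f y) (- a).
Proof. exact: is_deriveN. Qed.

Lemma is_derive_mul f g x a b : is_derive x 1 f a -> is_derive x 1 g b ->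
  is_derive x 1 (fun y => f y * g y) (f x * b + g x * a).
Proof. exact: is_deriveM. Qed.

Lemma is_derive_const c x : is_derive x 1 (fun=> c) 0.
Proof. exact: is_derive_cst. Qed.

Lemma is_derive_var x : is_derive x 1 (fun y : R => y) 1.
Proof. exact: is_derive_id. Qed.

Lemma is_derive_inv f x a : f x != 0 -> is_derive x 1 f a ->
  is_derive x 1 (fun y => (f y)^-1) (- (f x ^+ 2)^-1 * a).
Proof. by move=> fx0 fa; exact: is_deriveV. Qed.

Lemma is_derive_chain F f x a b : is_derive (f x) 1 F a -> is_derive x 1 f b ->
  is_derive x 1 (fun y => F (f y)) (a * b).
Proof. exact: is_derive1_comp. Qed.

Lemma is_derive_sqr f x a : is_derive x 1 f a ->
  is_derive x 1 (fun y => f y ^+ 2) (2 * f x * a).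
Proof. by move=> h; apply: is_derive_eq (is_derive_mul h h) _; ring. Qed.

Lemma is_derive_cos_comp f x a : is_derive x 1 f a ->
  is_derive x 1 (fun y => cos (f y)) (- sin (f x) * a).
Proof. by move=> h; apply: is_derive_chain. Qed.

Lemma is_derive_sin_comp f x a : is_derive x 1 f a ->
  is_derive x 1 (fun y => sin (f y)) (cos (f x) * a).
Proof. by move=> h; apply: is_derive_chain. Qed.

Lemma is_derive_expR_comp f x a : is_derive x 1 f a ->
  is_derive x 1 (fun y => expR (f y)) (expR (f x) * a).
Proof. by move=> h; apply: is_derive_chain. Qed.

Lemma is_derive_atan_comp f x a : is_derive x 1 f a ->
  is_derive x 1 (fun y => atan (f y)) ((1 + f x ^+ 2)^-1 * a).
Proof. by move=> h; apply: is_derive_chain. Qed.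

Lemma is_derive_powR_comp f x a p : 0 < f x -> is_derive x 1 f a ->
  is_derive x 1 (fun y => f y `^ p) (p * f x `^ (p - 1) * a).
Proof.
move=> fx0 h; have h1 := is_derive1_powR p fx0.
exact: (@is_derive_chain (fun y => y `^ p)).
Qed.

Lemma is_derive_cvg f x a : is_derive x 1 f a -> {for x, continuous f}.
Proof. by case=> df _; exact/differentiable_continuous/derivable1_diffP. Qed.

Lemma is_derive_val f x a : is_derive x 1 f a -> derive1 f x = a.
Proof. by case=> _ <-; rewrite derive1E. Qed.

Lemma is_derive_within f (df : R -> R) a b :
  (forall x, a <= x <= b -> is_derive x 1 f (df x)) ->
  {within `[a, b], continuous f}.
Proof.
move=> fE; apply: continuous_in_subspaceT => x; rewrite inE/= in_itv/= => xab.
exact: is_derive_cvg (fE _ xab).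
Qed.

Lemma ge0_derive_le f (df : R -> R) a b : a <= b ->
  (forall x, a <= x <= b -> is_derive x 1 f (df x)) ->
  (forall x, a <= x <= b -> 0 <= df x) -> f a <= f b.
Proof.
move=> ab fE df0; rewrite -subr_ge0.
have [x||c + ->] := @MVT_segment _ f df _ _ ab; first 2 last.
- by rewrite in_itv/= => /df0 ?; rewrite mulr_ge0// subr_ge0.
- by rewrite in_itv/= => /andP[/ltW ax /ltW xb]; apply: fE; rewrite ax xb.
- exact: is_derive_within fE.
Qed.

Lemma le0_derive_le f (df : R -> R) a b : a <= b ->
  (forall x, a <= x <= b -> is_derive x 1 f (df x)) ->
  (forall x, a <= x <= b -> df x <= 0) -> f b <= f a.
Proof.
move=> ab fE df0; rewrite -lerN2.
apply: (@ge0_derive_le (fun x => - f x) (fun x => - df x)) => // x xab.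
  exact/is_derive_opp/fE.
by rewrite oppr_ge0 df0.
Qed.

Lemma gt0_derive_lt f (df : R -> R) a b : a < b ->
  (forall x, a <= x <= b -> is_derive x 1 f (df x)) ->
  (forall x, a < x < b -> 0 < df x) -> f a < f b.
Proof.
move=> ab fE df0; rewrite -subr_gt0.
have [x||c + ->] := @MVT _ f df _ _ ab; first 2 last.
- by rewrite in_itv/= => /df0 ?; rewrite mulr_gt0// subr_gt0.
- by rewrite in_itv/= => /andP[/ltW ax /ltW xb]; apply: fE; rewrite ax xb.
- exact: is_derive_within fE.
Qed.

Lemma continuous_add f g : continuous f -> continuous g ->
  continuous (fun x => f x + g x).
Proof. by move=> cf cg x; apply: cvgD; [exact: cf|exact: cg]. Qed.

Lemma continuous_sub f g : continuous f -> continuous g ->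
  continuous (fun x => f x - g x).
Proof. by move=> cf cg x; apply: cvgB; [exact: cf|exact: cg]. Qed.

Lemma continuous_mul f g : continuous f -> continuous g ->
  continuous (fun x => f x * g x).
Proof. by move=> cf cg x; apply: cvgM; [exact: cf|exact: cg]. Qed.

Lemma continuous_sqr f : continuous f -> continuous (fun x => f x ^+ 2).
Proof. exact: (fun h => continuous_mul h h). Qed.

Lemma continuous_const c : continuous (fun _ : R => c).
Proof. by move=> x; exact: cvg_cst. Qed.

Lemma continuous_var : continuous (fun x : R => x).
Proof. by move=> x. Qed.

Lemma continuous_shift c : continuous (fun x : R => x + c).
Proof. by move=> x; apply: cvgD => //; exact: cvg_cst. Qed.

Lemma continuous_comp_fun F f : continuous F -> continuous f ->
  continuous (fun x => F (f x)).
Proof. by move=> cF cf x; apply: continuous_comp; [exact: cf|exact: cF]. Qed.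

Lemma continuous_sum (I : Type) (r : seq I) (F : I -> R -> R) :
  (forall i, continuous (F i)) -> continuous (fun x => \sum_(i <- r) F i x).
Proof.
move=> cF; elim: r => [|i r IH].
  have -> : (fun x : R => \sum_(i <- [::]) F i x) = fun=> 0.
    by apply/funext => x; rewrite big_nil.
  exact: continuous_const.
have -> : (fun x : R => \sum_(j <- i :: r) F j x) =
          fun x => F i x + \sum_(j <- r) F j x.
  by apply/funext => x; rewrite big_cons.
exact: continuous_add.
Qed.

End Calculus.

(** Derivatives and continuity are obtained by recursion on the syntax of the
    function, since unification up to conversion would unfold the
    transcendental functions. *)
Ltac der_step :=
  lazymatch goal with
  | |- is_derive _ _ ?f _ =>
  lazymatch f with
  | fun _ => ?c => eapply is_derive_const
  | fun t => (@?u t - @?v t)%R => eapply (@is_derive_sub _ u v)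
  | fun t => (@?u t + @?v t)%R => eapply (@is_derive_add _ u v)
  | fun t => (- @?u t)%R => eapply (@is_derive_opp _ u)
  | fun t => (@?u t ^+ 2)%R => eapply (@is_derive_sqr _ u)
  | fun t => (@?u t * @?v t)%R => eapply (@is_derive_mul _ u v)
  | fun t => cos (@?u t) => eapply (@is_derive_cos_comp _ u)
  | fun t => sin (@?u t) => eapply (@is_derive_sin_comp _ u)
  | fun t => expR (@?u t) => eapply (@is_derive_expR_comp _ u)
  | fun t => atan (@?u t) => eapply (@is_derive_atan_comp _ u)
  | fun t => (@?u t `^ ?p)%R => eapply (@is_derive_powR_comp _ u)
  | fun t => ((@?u t)^-1)%R => eapply (@is_derive_inv _ u)
  | fun t => t => eapply is_derive_var
  | fun t => ?F (@?u t) => first [eassumption | eapply (@is_derive_chain _ F u)]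
  | _ => eassumption
  end
  | _ => eassumption
  end.
Ltac der := eapply is_derive_eq; [repeat der_step|].
Ltac cont_step :=
  first [eassumption |
  lazymatch goal with |- forall x, continuous_at x ?f =>
  lazymatch f with
  | fun _ => ?c => eapply continuous_const
  | fun t => (@?u t - @?v t)%R => eapply (@continuous_sub _ u v)
  | fun t => (@?u t + @?v t)%R => eapply (@continuous_add _ u v)
  | fun t => (@?u t ^+ 2)%R => eapply (@continuous_sqr _ u)
  | fun t => (@?u t * @?v t)%R => eapply (@continuous_mul _ u v)
  | fun t => cos (@?u t) => eapply (@continuous_comp_fun _ _ u (@continuous_cos _))
  | fun t => sin (@?u t) => eapply (@continuous_comp_fun _ _ u (@continuous_sin _))
  | fun t => t => exact: continuous_var
  | _ => apply: continuous_sum => ?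
  end end].
Ltac cont := repeat cont_step.

Section Integral.
Variable R : realType.
Implicit Types (f g F : R -> R) (a b c x y : R).
Local Notation mu := (@lebesgue_measure R).
Local Notation itg a b f := (\int[mu]_(x in `[a, b]) f x).

Lemma continuous_integrable a b f : continuous f ->
  mu.-integrable `[a, b] (EFin \o f).
Proof.
move=> cf; apply: continuous_compact_integrable; first exact: segment_compact.
exact: continuous_subspaceT.
Qed.

Lemma itgD f g a b : continuous f -> continuous g ->
  itg a b (fun x => f x + g x) = itg a b f + itg a b g.
Proof. by move=> cf cg; apply: RintegralD => //; exact: continuous_integrable. Qed.

Lemma itgZ f c a b : continuous f -> itg a b (fun x => c * f x) = c * itg a b f.
Proof. by move=> cf; apply: RintegralZl => //; exact: continuous_integrable. Qed.

Lemma itg_sum (I : Type) (r : seq I) (F : I -> R -> R) a b :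
  (forall i, continuous (F i)) ->
  itg a b (fun x => \sum_(i <- r) F i x) = \sum_(i <- r) itg a b (F i).
Proof.
move=> cF; elim: r => [|i r IH].
  rewrite big_nil (_ : (fun x => _) = fun=> 0 * 0); last first.
    by apply/funext => x; rewrite big_nil mul0r.
  by rewrite itgZ ?mul0r//; exact: continuous_const.
rewrite big_cons -IH -itgD//; last exact: continuous_sum.
by apply: eq_Rintegral => x _; rewrite big_cons.
Qed.

Lemma itg_le f g a b : continuous f -> continuous g ->
  (forall x, a <= x <= b -> f x <= g x) -> itg a b f <= itg a b g.
Proof.
move=> cf cg fg.
apply: (le_Rintegral _ (continuous_integrable a b cf) (continuous_integrable a b cg)) => //.
Qed.

Lemma itg_ge0 f a b : (forall x, a <= x <= b -> 0 <= f x) -> 0 <= itg a b f.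
Proof. by move=> f0; apply: Rintegral_ge0 => x /=; rewrite in_itv/= => /f0. Qed.

Lemma itg_const a b c : a <= b -> itg a b (fun=> c) = c * (b - a).
Proof.
move=> ab; rewrite Rintegral_cst//= lebesgue_measure_itv/= lte_fin.
by case: ltgtP ab => [//|//|-> _]; rewrite subrr.
Qed.

Lemma itg_ftc f F a b : a <= b -> continuous f ->
  (forall x, a <= x <= b -> is_derive x 1 F (f x)) -> itg a b f = F b - F a.
Proof.
rewrite le_eqVlt => /predU1P[-> _ _|ab cf FE].
  by rewrite set_itv1 Rintegral_set1 subrr.
have FEa : is_derive a 1 F (f a) by apply: FE; rewrite lexx ltW.
have FEb : is_derive b 1 F (f b) by apply: FE; rewrite lexx ltW.
rewrite /Rintegral (@continuous_FTC2 _ f F a b)//.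
- exact: continuous_subspaceT.
- split.
  + by move=> x; rewrite in_itv/= => /andP[/ltW ax /ltW xb]; case: (FE x); rewrite ?ax ?xb.
  + by apply: cvg_at_right_filter; exact: is_derive_cvg FEa.
  + by apply: cvg_at_left_filter; exact: is_derive_cvg FEb.
- move=> x; rewrite in_itv/= => /andP[/ltW ax /ltW xb].
  by apply: is_derive_val; apply: FE; rewrite ax xb.
Qed.

Lemma itg_shift f s a b : a <= b -> continuous f ->
  itg a b (fun t => f (t + s)) = itg (a + s) (b + s) f.
Proof.
move=> ab cf.
pose F x := itg (a + s - 1) x f.
have FE x : a + s <= x <= b + s -> is_derive x 1 F (f x).
  move=> /andP[ax xb].
  have h1 : x < b + s + 1 by rewrite (le_lt_trans xb)// ltrDl.
  have h2 : a + s - 1 < x by rewrite (lt_le_trans _ ax)// ltrBlDr ltrDl.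
  have [dF FE] := continuous_FTC1_closed h1 (continuous_integrable _ _ cf) h2 (cf x).
  by split; [exact: dF|rewrite -derive1E; exact: FE].
have cfs : continuous (fun t => f (t + s)).
  by apply: continuous_comp_fun => //; exact: continuous_shift.
have absh : a + s <= b + s by rewrite lerD2r.
rewrite (itg_ftc absh cf FE).
apply: (@itg_ftc _ (fun t => F (t + s))) => // x xab.
have h : is_derive (x + s) 1 F (f (x + s)) by apply: FE; rewrite !lerD2r.
have h2 : is_derive x 1 (fun t : R => t + s) 1 by der; rewrite addr0.
by apply: is_derive_eq (@is_derive_chain _ F (fun t => t + s) _ _ _ h h2) _; rewrite mulr1.
Qed.

Lemma itg_sub_itv f a b a' b' : a <= a' -> b' <= b -> continuous f ->
  (forall x, a <= x <= b -> 0 <= f x) -> itg a' b' f <= itg a b f.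
Proof.
move=> aa bb cf f0; apply: fine_le.
- by apply: integrable_fin_num => //; exact: continuous_integrable.
- by apply: integrable_fin_num => //; exact: continuous_integrable.
apply: ge0_subset_integral => //.
- by have /integrableP[] := @continuous_integrable a b f cf.
- by move=> x /=; rewrite !in_itv/= => /andP[h1 h2]; rewrite (le_trans aa)//= (le_trans h2).
Qed.

(** The Cauchy-Schwarz inequality against a constant: the variance of [f] is
    nonnegative. *)
Lemma itg_sqr_ge f d : 0 < d -> continuous f ->
  (itg 0 d f) ^+ 2 <= d * itg 0 d (fun x => f x ^+ 2).
Proof.
move=> d0 cf; set m := itg 0 d f.
have : 0 <= itg 0 d (fun x => f x ^+ 2 + ((- 2 * (m / d)) * f x + (m / d) ^+ 2)).
  apply: itg_ge0 => x _.
  by rewrite (_ : _ + _ = (f x - m / d) ^+ 2) ?sqr_ge0//; field; rewrite gt_eqF.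
rewrite itgD; [|by cont|by cont].
rewrite itgD; [|by cont|by cont].
rewrite itgZ// (itg_const _ (ltW d0)) -/m subr0 => h.
have -> : m ^+ 2 = d * (- (- 2 * (m / d) * m + (m / d) ^+ 2 * d)).
  by field; rewrite gt_eqF.
by rewrite ler_pM2l//; lra.
Qed.

End Integral.

(** * Trigonometric sums against a cosine weight *)

Section TrigSums.
Variable R : realType.
Implicit Types (w A B : nat -> R) (a b p L t x : R) (k l n : nat).
Local Notation mu := (@lebesgue_measure R).
Local Notation itg a b f := (\int[mu]_(x in `[a, b]) f x).

Definition trigsum w A B n t :=
  \sum_(k < n) (A k * cos (w k * t) + B k * sin (w k * t)).

Definition coef2 A B n := \sum_(k < n) (A k ^+ 2 + B k ^+ 2).

Definition cosine_kernel L p x := itg (- L) L (fun t => cos (p * t) * cos (x * t)).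

Lemma continuous_trigsum w A B n : continuous (trigsum w A B n).
Proof. by rewrite /trigsum; cont. Qed.

Lemma itg_sin L x : 0 <= L -> itg (- L) L (fun t => sin (x * t)) = 0.
Proof.
move=> L0; have LL : - L <= L by lra.
have cs : continuous (fun t : R => sin (x * t)) by cont.
have [x0|x0] := eqVneq x 0.
  transitivity (itg (- L) L (fun=> 0)); last by rewrite itg_const// mul0r.
  by apply: eq_Rintegral => t _; rewrite x0 mul0r sin0.
have FE t : - L <= t <= L ->
    is_derive t 1 (fun t => - x^-1 * cos (x * t)) (sin (x * t)).
  by move=> _; der; field.
by rewrite (itg_ftc LL cs FE) mulrN cosN subrr.
Qed.

Lemma cosine_kernel_sin L p x : 0 <= L ->
  itg (- L) L (fun t => cos (p * t) * sin (x * t)) = 0.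
Proof.
move=> L0.
transitivity (itg (- L) L (fun t =>
    2^-1 * sin ((x + p) * t) + 2^-1 * sin ((x - p) * t))).
  by apply: eq_Rintegral => t _; rewrite mulrDl mulrBl sinD sinB; field.
by rewrite itgD ?itgZ ?itg_sin ?mulr0 ?addr0//; cont.
Qed.

Lemma cosine_kernelE L x : 0 < L -> let p := pi / (2 * L) in
  p ^+ 2 != x ^+ 2 ->
  cosine_kernel L p x = 2 * p * cos (x * L) / (p ^+ 2 - x ^+ 2).
Proof.
move=> L0 p px; have LL : - L <= L by lra.
have px0 : p ^+ 2 - x ^+ 2 != 0 by rewrite subr_eq0.
have pL : p * L = pi / 2 by rewrite /p; field; rewrite gt_eqF.
have cs : continuous (fun t : R => cos (p * t) * cos (x * t)) by cont.
have FE t : - L <= t <= L -> is_derive t 1 (fun t =>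
    (p * sin (p * t) * cos (x * t) - x * cos (p * t) * sin (x * t))
    * (p ^+ 2 - x ^+ 2)^-1) (cos (p * t) * cos (x * t)).
  by move=> _; der; field.
rewrite /cosine_kernel (itg_ftc LL cs FE) !mulrN !cosN !sinN pL.
by rewrite sin_pihalf cos_pihalf; field.
Qed.

Lemma itg_trig_mul L p a b (A1 B1 A2 B2 : R) : 0 <= L ->
  itg (- L) L (fun t => cos (p * t) *
    ((A1 * cos (a * t) + B1 * sin (a * t)) *
     (A2 * cos (b * t) + B2 * sin (b * t)))) =
  2^-1 * (A1 * A2 * (cosine_kernel L p (a - b) + cosine_kernel L p (a + b)) +
          B1 * B2 * (cosine_kernel L p (a - b) - cosine_kernel L p (a + b))).
Proof.
move=> L0.
transitivity (itg (- L) L (fun t =>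
   2^-1 * (A1 * A2 + B1 * B2) * (cos (p * t) * cos ((a - b) * t)) +
   2^-1 * (A1 * A2 - B1 * B2) * (cos (p * t) * cos ((a + b) * t)) +
   (2^-1 * (A1 * B2 + B1 * A2) * (cos (p * t) * sin ((a + b) * t)) +
    2^-1 * (B1 * A2 - A1 * B2) * (cos (p * t) * sin ((a - b) * t))))).
  apply: eq_Rintegral => t _.
  rewrite [(a - b) * t]mulrBl [(a + b) * t]mulrDl cosB cosD sinB sinD.
  by field.
rewrite !itgD ?itgZ ?cosine_kernel_sin//; try by cont.
by rewrite /cosine_kernel; field.
Qed.

Lemma itg_trigsum_sqr L p w A B n : 0 <= L ->
  itg (- L) L (fun t => cos (p * t) * trigsum w A B n t ^+ 2) =
  2^-1 * \sum_(k < n) \sum_(l < n)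
    (A k * A l * (cosine_kernel L p (w k - w l) + cosine_kernel L p (w k + w l)) +
     B k * B l * (cosine_kernel L p (w k - w l) - cosine_kernel L p (w k + w l))).
Proof.
move=> L0.
transitivity (itg (- L) L (fun t => \sum_(k < n) \sum_(l < n)
   cos (p * t) * ((A k * cos (w k * t) + B k * sin (w k * t)) *
     (A l * cos (w l * t) + B l * sin (w l * t))))).
  apply: eq_Rintegral => t _; rewrite expr2 /trigsum mulr_suml mulr_sumr.
  by apply: eq_bigr => k _; rewrite !mulr_sumr.
rewrite itg_sum; last by move=> k; cont.
rewrite mulr_sumr; apply: eq_bigr => k _.
rewrite itg_sum; last by move=> l; cont.
by rewrite mulr_sumr; apply: eq_bigr => l _; rewrite itg_trig_mul.
Qed.

(** Since [2 * |x_k x_l| <= x_k^2 + x_l^2], the symmetry of [h] reduces the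
    quadratic form to the row sums of [h]. *)
Lemma schur_test (x : nat -> R) (g h : nat -> nat -> R) rho n :
  (forall k l, h k l = h l k) -> (forall k l, `|g k l| <= h k l) ->
  (forall k, (k < n)%N -> \sum_(l < n) h k l <= rho) ->
  `|\sum_(k < n) \sum_(l < n) x k * x l * g k l| <= rho * \sum_(k < n) x k ^+ 2.
Proof.
move=> hC gh hrho.
apply: (@le_trans _ _ (\sum_(k < n) \sum_(l < n)
   (2^-1 * (x k ^+ 2 * h k l) + 2^-1 * (x l ^+ 2 * h k l)))).
  apply: (le_trans (ler_norm_sum _ _ _)); apply: ler_sum => k _.
  apply: (le_trans (ler_norm_sum _ _ _)); apply: ler_sum => l _.
  rewrite !normrM -mulrDr -mulrDl mulrA; apply: ler_pM => //.
  have := sqr_ge0 (`|x k| - `|x l|); rewrite -(real_normK (num_real (x k))).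
  by rewrite -(real_normK (num_real (x l))); nra.
pose S := \sum_(k < n) \sum_(l < n) x k ^+ 2 * h k l.
have S2 : \sum_(k < n) \sum_(l < n) x l ^+ 2 * h k l = S.
  by rewrite exchange_big/=; apply: eq_bigr => k _; apply: eq_bigr => l _; rewrite hC.
have SE : S <= rho * \sum_(k < n) x k ^+ 2.
  rewrite mulr_sumr; apply: ler_sum => k _; rewrite -mulr_sumr mulrC.
  by rewrite ler_wpM2r ?sqr_ge0// hrho.
rewrite (eq_bigr (fun k : 'I_n => 2^-1 * (\sum_(l < n) x k ^+ 2 * h k l) +
   2^-1 * \sum_(l < n) x l ^+ 2 * h k l)); last first.
  by move=> k _; rewrite big_split/= -!mulr_sumr.
by rewrite big_split/= -!mulr_sumr S2 -/S; lra.
Qed.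

End TrigSums.

(** * Ingham's inequality under a uniform gap *)

Section Ingham.
Variable R : realType.
Implicit Types (w A B : nat -> R) (a b p L t x g : R) (k l n : nat).
Local Notation mu := (@lebesgue_measure R).
Local Notation itg a b f := (\int[mu]_(x in `[a, b]) f x).

(** A sum of cosines and sines of frequencies [w k] involves the exponentials
    of frequencies [w k] and [- w k]; the condition on [w 0] is the gap between
    the two middle terms of this symmetric family. *)
Definition uniform_gap g w := (forall k, g <= w k.+1 - w k) /\ g <= 2 * w 0%N.

Lemma uniform_gap_sub g w k l : uniform_gap g w -> (k <= l)%N ->
  (l - k)%:R * g <= w l - w k.
Proof.
move=> [wS _]; elim: l => [|l IH].
  by rewrite leqn0 => /eqP ->; rewrite mul0r subrr.
rewrite leq_eqVlt => /predU1P[->|]; first by rewrite subnn mul0r subrr.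
rewrite ltnS => kl; have := wS l; have := IH kl.
by rewrite subSn// -natr1; lra.
Qed.

Lemma uniform_gap_add g w k l : uniform_gap g w ->
  (k + l).+1%:R * g <= w k + w l.
Proof.
move=> wg; have := uniform_gap_sub wg (leq0n k); have := uniform_gap_sub wg (leq0n l).
by rewrite !subn0 -natr1 natrD; case: wg => _; lra.
Qed.

(** The increments of this sequence, [2 / (4 n^2 - 1)] after a shift of [n],
    are the decay of Ingham's kernel at [n] gaps, and sum by telescoping. *)
Definition inv_odd n : R := (2 * n%:R + 1)^-1.

Lemma inv_odd_ge0 n : 0 <= inv_odd n.
Proof. by rewrite invr_ge0 addr_ge0// mulr_ge0. Qed.

Lemma cosine_kernel_le L g n x : 0 < L -> pi < L * g -> 0 < g ->
  n.+1%:R * g <= x ->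
  `|cosine_kernel L (pi / (2 * L)) x| <=
  4 * (pi / (2 * L)) / g ^+ 2 * (inv_odd n - inv_odd n.+1).
Proof.
move=> L0 Lg g0 nx; set p := pi / (2 * L).
have p0 : 0 < p by rewrite divr_gt0 ?pi_gt0// mulr_gt0.
have pg : 2 * p < g.
  by rewrite /p (_ : 2 * _ = pi / L) ?ltr_pdivrMr// 1?mulrC//; field; rewrite gt_eqF.
have n1 : 1 <= n.+1%:R :> R by rewrite ler1n.
have x0 : 0 < x by apply: lt_le_trans nx; rewrite mulr_gt0// ltr0n.
have D0 : 0 < (4 * n.+1%:R ^+ 2 - 1) * g ^+ 2.
  by rewrite mulr_gt0// ?exprn_gt0//; nra.
have Dx : (4 * n.+1%:R ^+ 2 - 1) * g ^+ 2 <= 4 * (x ^+ 2 - p ^+ 2).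
  have : (n.+1%:R * g) ^+ 2 <= x ^+ 2.
    by rewrite lerXn2r// nnegrE ?ltW// mulr_gt0// ltr0n.
  by rewrite exprMn; nra.
have xp : 0 < x ^+ 2 - p ^+ 2 by lra.
rewrite cosine_kernelE//; last by rewrite -subr_eq0 -opprB oppr_eq0 gt_eqF.
have q0 : 0 < 2 * p / (x ^+ 2 - p ^+ 2) by rewrite divr_gt0// mulr_gt0.
have -> : 2 * p * cos (x * L) / (p ^+ 2 - x ^+ 2) =
    - (cos (x * L) * (2 * p / (x ^+ 2 - p ^+ 2))).
  by field; rewrite -[p ^+ 2 - _]opprB oppr_eq0 andbb gt_eqF.
rewrite normrN normrM (gtr0_norm q0).
apply: (@le_trans _ _ (2 * p / (x ^+ 2 - p ^+ 2))).
  by rewrite -[leRHS]mul1r ler_pM2r// cos_max.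
have -> : 4 * p / g ^+ 2 * (inv_odd n - inv_odd n.+1) =
          8 * p / ((4 * n.+1%:R ^+ 2 - 1) * g ^+ 2).
  have h : 4 * n.+1%:R ^+ 2 - 1 = (2 * n%:R + 1) * (2 * n%:R + 3) :> R.
    by rewrite -natr1; ring.
  have n0 : 0 <= n%:R :> R by [].
  rewrite h /inv_odd -natr1; field; rewrite !gt_eqF//; lra.
rewrite ler_pdivrMr// mulrAC ler_pdivlMr//; nra.
Qed.

Lemma sum_inv_odd (a n : nat) : \sum_(0 <= j < n) (inv_odd (a + j) - inv_odd (a + j).+1)
  = inv_odd a - inv_odd (a + n).
Proof.
rewrite (eq_bigr (fun j => - (inv_odd (a + j.+1) - inv_odd (a + j)))); last first.
  by move=> j _; rewrite opprB addnS.
by rewrite sumrN (@telescope_sumr _ 0 n (fun j => inv_odd (a + j)))// opprB addn0.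
Qed.

Definition kernel_row L p w k l : R :=
  (if k == l then 0 else `|cosine_kernel L p (w k - w l)|)
  + `|cosine_kernel L p (w k + w l)|.

Lemma cosine_kernelN L p x : cosine_kernel L p (- x) = cosine_kernel L p x.
Proof. by apply: eq_Rintegral => t _; rewrite mulNr cosN. Qed.

(** By telescoping, the frequencies above [w k] contribute at most one unit
    [4 p / g^2]; so do those below [w k] together with the opposite frequencies
    [- w l], which prolong the sequence downwards with the same spacing. *)
Lemma kernel_row_sum L g w n k : 0 < L -> pi < L * g -> 0 < g ->
  uniform_gap g w -> (k < n)%N ->
  \sum_(l < n) kernel_row L (pi / (2 * L)) w k l <=
  8 * (pi / (2 * L)) / g ^+ 2.
Proof.
move=> L0 Lg g0 wg kn; set p := pi / (2 * L); set c := 4 * p / g ^+ 2.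
have c0 : 0 <= c.
  by rewrite divr_ge0 ?sqr_ge0// mulr_ge0// divr_ge0 ?pi_ge0// mulr_ge0// ltW.
have Ksum l : `|cosine_kernel L p (w k + w l)| <=
    c * (inv_odd (k + l) - inv_odd (k + l).+1).
  by apply: cosine_kernel_le => //; exact: uniform_gap_add.
have Kleft l : (l < k)%N -> `|cosine_kernel L p (w k - w l)| <=
    c * (inv_odd (k - l.+1) - inv_odd (k - l.+1).+1).
  move=> lk; apply: cosine_kernel_le => //; rewrite -subSn// subSS.
  by apply: uniform_gap_sub => //; exact: ltnW.
have Kright l : (k < l)%N -> `|cosine_kernel L p (w k - w l)| <=
    c * (inv_odd (l - k.+1) - inv_odd (l - k.+1).+1).
  move=> kl; rewrite -opprB cosine_kernelN; apply: cosine_kernel_le => //.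
  by rewrite -subSn// subSS; apply: uniform_gap_sub => //; exact: ltnW.
rewrite -(big_mkord xpredT (kernel_row L p w k)) big_split/=.
have S3 : \sum_(0 <= l < n) `|cosine_kernel L p (w k + w l)| <=
    c * (inv_odd k - inv_odd (k + n)).
  by rewrite -sum_inv_odd mulr_sumr; apply: ler_sum => l _.
have S1 : \sum_(0 <= l < k) (if k == l then 0 else `|cosine_kernel L p (w k - w l)|)
    <= c * (inv_odd 0 - inv_odd k).
  rewrite -[inv_odd k]/(inv_odd (0 + k)) -sum_inv_odd mulr_sumr.
  rewrite [leRHS]big_nat_rev/= big_nat [leRHS]big_nat; apply: ler_sum => l /andP[_ lk].
  by rewrite gtn_eqF// !add0n Kleft.
have S2 : \sum_(k.+1 <= l < n) (if k == l then 0 else `|cosine_kernel L p (w k - w l)|)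
    <= c * (inv_odd 0 - inv_odd (n - k.+1)).
  rewrite -[inv_odd (n - _)]/(inv_odd (0 + _)) -sum_inv_odd mulr_sumr.
  rewrite -{1}[k.+1]add0n big_addn big_nat [leRHS]big_nat; apply: ler_sum => l _.
  rewrite ltn_eqF; last by rewrite addnS ltnS leq_addl.
  by rewrite add0n (le_trans (Kright _ _))// ?addnK// addnS ltnS leq_addl.
rewrite (big_cat_nat (n := k))//= 1?ltnW// [X in _ + X + _]big_ltn// eqxx add0r.
have i0 : inv_odd 0 = 1 :> R by rewrite /inv_odd mulr0 add0r invr1.
have h1 := mulr_ge0 c0 (inv_odd_ge0 (k + n)).
have h2 := mulr_ge0 c0 (inv_odd_ge0 (n - k.+1)).
have -> : 8 * p / g ^+ 2 = c + c by rewrite /c; field; rewrite gt_eqF.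
move: S1 S2 S3; rewrite i0 !mulrBr mulr1; lra.
Qed.

(** The diagonal terms of the quadratic form give [p^-1 * coef2 A B n]. The
    weight [cos (p * t)] vanishes at both ends of the interval, so its
    transform decays quadratically, and the other terms are controlled by the
    Schur test. *)
Lemma ingham_kernel L g w A B n : 0 < L -> pi < L * g -> 0 < g ->
  uniform_gap g w -> let p := pi / (2 * L) in
  `|itg (- L) L (fun t => cos (p * t) * trigsum w A B n t ^+ 2)
    - p^-1 * coef2 A B n| <= 4 * p / g ^+ 2 * coef2 A B n.
Proof.
move=> L0 Lg g0 wg /=; set p := pi / (2 * L).
have p0 : 0 < p by rewrite divr_gt0 ?pi_gt0// mulr_gt0.
have K0 : cosine_kernel L p 0 = 2 / p.
  rewrite cosine_kernelE//; last by rewrite expr0n gt_eqF// exprn_gt0.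
  by rewrite mul0r cos0 -/p; field; rewrite gt_eqF.
pose gp k l := (if k == l then 0 else cosine_kernel L p (w k - w l))
  + cosine_kernel L p (w k + w l).
pose gm k l := (if k == l then 0 else cosine_kernel L p (w k - w l))
  - cosine_kernel L p (w k + w l).
have rC k l : kernel_row L p w k l = kernel_row L p w l k.
  by rewrite /kernel_row eq_sym -opprB cosine_kernelN [w k + _]addrC.
have gph k l : `|gp k l| <= kernel_row L p w k l.
  rewrite /gp /kernel_row; case: eqP => _; first by rewrite !add0r.
  exact: ler_normD.
have gmh k l : `|gm k l| <= kernel_row L p w k l.
  rewrite /gm /kernel_row; case: eqP => _; first by rewrite !add0r normrN.
  by rewrite (le_trans (ler_normD _ _))// normrN.
have row k (kn : (k < n)%N) := kernel_row_sum L0 Lg g0 wg kn.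
have SA := schur_test A rC gph row.
have SB := schur_test B rC gmh row.
rewrite (itg_trigsum_sqr _ _ _ _ _ (ltW L0)) -/p.
have -> : \sum_(k < n) \sum_(l < n)
    (A k * A l * (cosine_kernel L p (w k - w l) + cosine_kernel L p (w k + w l)) +
     B k * B l * (cosine_kernel L p (w k - w l) - cosine_kernel L p (w k + w l)))
  = 2 / p * coef2 A B n + (\sum_(k < n) \sum_(l < n) A k * A l * gp k l
     + \sum_(k < n) \sum_(l < n) B k * B l * gm k l).
  rewrite /coef2 mulr_sumr -!big_split/=; apply: eq_bigr => k _.
  rewrite -big_split/= (bigD1 k)//= [X in _ = _ + X](bigD1 k)//= addrA; congr (_ + _).
    by rewrite /gp /gm eqxx subrr K0; field; rewrite gt_eqF.
  apply: eq_bigr => l lk; rewrite /gp /gm ifN//.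
  by move: lk; apply: contraNneq => kl; apply/eqP/val_inj.
have -> : coef2 A B n = \sum_(k < n) A k ^+ 2 + \sum_(k < n) B k ^+ 2.
  by rewrite /coef2 big_split.
set sA := \sum_(k < n) A k ^+ 2 in SA *; set sB := \sum_(k < n) B k ^+ 2 in SB *.
set a1 := \sum_(k < n) _ in SA *; set a2 := \sum_(k < n) _ in SB *.
have -> : 2^-1 * (2 / p * (sA + sB) + (a1 + a2)) - p^-1 * (sA + sB) = 2^-1 * (a1 + a2).
  by field; rewrite gt_eqF.
have -> : 4 * p / g ^+ 2 * (sA + sB) =
   2^-1 * (8 * p / g ^+ 2 * sA + 8 * p / g ^+ 2 * sB) by field; rewrite gt_eqF.
rewrite normrM ger0_norm// ler_pM2l// (le_trans (ler_normD _ _))//.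
exact: lerD.
Qed.

End Ingham.

(** * Separation of frequencies by cardinal sines *)

Section Sinc.
Variable R : realType.
Implicit Types (a b d x : R).
Local Notation mu := (@lebesgue_measure R).
Local Notation itg a b f := (\int[mu]_(x in `[a, b]) f x).

Lemma mulr_cos_le_sin x : 0 <= x <= pi -> x * cos x <= sin x.
Proof.
move=> /andP[x0 xpi]; rewrite -subr_ge0.
have -> : 0 = sin 0 - 0 * cos 0 :> R by rewrite sin0 mul0r subrr.
apply: (@ge0_derive_le _ (fun y => sin y - y * cos y) (fun y => y * sin y)) => //.
  by move=> y _; der; ring.
move=> y /andP[y0 yx]; rewrite mulr_ge0// sin_ge0_pi// y0.
exact: le_trans xpi.
Qed.

Lemma sinc_decreasing a x : 0 < a -> a < x -> x <= pi -> a * sin x < x * sin a.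
Proof.
move=> a0 ax xpi; rewrite -subr_gt0.
have -> : 0 = a * sin a - a * sin a by rewrite subrr.
apply: (@gt0_derive_lt _ (fun y => y * sin a - a * sin y)
          (fun y => sin a - a * cos y)) => //.
  by move=> y _; der; ring.
move=> y /andP[ay yx].
have aI : a \in `[0, pi] by rewrite in_itv/= ltW//= (le_trans (ltW ax)).
have yI : y \in `[0, pi].
  by rewrite in_itv/= (ltW (lt_trans a0 ay))/= (le_trans (ltW yx)).
have : cos y < cos a by rewrite ltr_cos.
have := @mulr_cos_le_sin a; rewrite ltW//= (le_trans (ltW ax) xpi) => /(_ isT).
by move: a0; nra.
Qed.

Lemma norm_sin_lt x : 0 < x -> `|sin x| < x.
Proof.
move=> x0; have [x1|x1] := ltP 1 x; first exact: le_lt_trans (sin_max x) x1.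
have xpi : x < pi by rewrite (le_lt_trans x1)// (lt_le_trans _ (pi_ge2 R))// ltr1n.
rewrite ger0_norm; last by rewrite sin_ge0_pi// !ltW.
rewrite -subr_gt0; have -> : 0 = 0 - sin 0 :> R by rewrite sin0 subrr.
apply: (@gt0_derive_lt _ (fun y => y - sin y) (fun y => 1 - cos y)) => //.
move=> y /andP[y0 yx]; rewrite subr_gt0 -(cos0 R) ltr_cos ?in_itv/= ?lexx ?pi_ge0//.
by rewrite ltW//= ltW// (lt_trans yx).
Qed.

(** Averaging over the shift [s] separates the frequency [a] from all
    frequencies at least [b] at once, which no single shift can do: the mean of
    [cos (x * s)] is a cardinal sine, and for [x >= b] it stays below its value
    at [b], hence away from its value at [a]. *)
Lemma cos_separation a b d : 0 < a -> a < b -> 0 < d -> b * d <= pi / 2 ->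
  exists2 c, 0 < c & forall x, b <= x ->
    c <= itg 0 d (fun s => (cos (x * s) - cos (a * s)) ^+ 2).
Proof.
move=> a0 ab d0 bd.
have b0 : 0 < b by exact: lt_trans ab.
have pi0 := pi_gt0 R.
have bd0 : 0 < b * d by rewrite mulr_gt0.
have ad0 : 0 < a * d by rewrite mulr_gt0.
have abd : a * d < b * d by rewrite ltr_pM2r.
pose sinc x : R := sin x / x.
have sincb : 1 / pi <= sinc (b * d).
  rewrite /sinc ler_pdivlMr// mulrAC ler_pdivrMr// mul1r.
  have : b * d * sin (pi / 2) <= (pi / 2) * sin (b * d).
    move: bd; rewrite le_eqVlt => /predU1P[->//|bd].
    by rewrite ltW// sinc_decreasing// ler_pdivrMr// ler_pMr// ler1n.
  by rewrite sin_pihalf; nra.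
have sinc_le x : b * d <= x -> sinc x <= sinc (b * d).
  move=> bx; have x0 : 0 < x by exact: lt_le_trans bx.
  have [xpi|xpi] := leP x pi.
    move: bx; rewrite le_eqVlt => /predU1P[->//|bx].
    rewrite /sinc ler_pdivrMr// mulrAC ler_pdivlMr// mulrC [leRHS]mulrC.
    by rewrite ltW// sinc_decreasing.
  apply: le_trans sincb; rewrite /sinc; apply: (@le_trans _ _ (1 / x)).
    by rewrite ler_pM2r ?invr_gt0// sin_le1.
  by rewrite !div1r lef_pV2// ?posrE// ltW.
have sinc_lt : sinc (b * d) < sinc (a * d).
  rewrite /sinc ltr_pdivrMr// mulrAC ltr_pdivlMr// mulrC [ltRHS]mulrC.
  by rewrite sinc_decreasing// (le_trans bd)// ler_pdivrMr// ler_pMr// ler1n.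
pose D := d * (sinc (a * d) - sinc (b * d)).
have D0 : 0 < D by rewrite mulr_gt0// subr_gt0.
exists (D ^+ 2 / d) => [|x bx]; first by rewrite divr_gt0// exprn_gt0.
have x0 : 0 < x by exact: lt_le_trans bx.
have cc : continuous (fun s : R => cos (x * s) - cos (a * s)) by cont.
rewrite ler_pdivrMr// mulrC; apply: le_trans (itg_sqr_ge d0 cc).
have FE s : 0 <= s <= d -> is_derive s 1
    (fun s => x^-1 * sin (x * s) - a^-1 * sin (a * s)) (cos (x * s) - cos (a * s)).
  by move=> _; der; field; rewrite !gt_eqF.
rewrite (itg_ftc (ltW d0) cc FE) !mulr0 sin0 !mulr0 subrr subr0.
have h : D <= - (x^-1 * sin (x * d) - a^-1 * sin (a * d)).
  have := sinc_le (x * d); rewrite ler_pM2r// => /(_ bx).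
  rewrite -(ler_pM2l d0) /D /sinc mulrBr.
  have -> : - (x^-1 * sin (x * d) - a^-1 * sin (a * d)) =
    d * (sin (a * d) / (a * d)) - d * (sin (x * d) / (x * d)).
    by field; rewrite !gt_eqF.
  by lra.
rewrite -[leRHS]sqrrN lerXn2r ?nnegrE//; first exact: ltW.
by rewrite (le_trans (ltW D0)).
Qed.

End Sinc.

(** * Observability of trigonometric sums *)

Section Observability.
Variable R : realType.
Implicit Types (w A B : nat -> R) (a b p L t x g : R) (k l n : nat).
Local Notation mu := (@lebesgue_measure R).
Local Notation itg a b f := (\int[mu]_(x in `[a, b]) f x).

Definition observable L w := exists2 c : R, 0 < c &
  forall A B n, c * coef2 A B n <= itg (- L) L (fun t => trigsum w A B n t ^+ 2).

Lemma trigsum_ge0_itg a b w A B n : 0 <= itg a b (fun t => trigsum w A B n t ^+ 2).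
Proof. by apply: itg_ge0 => t _; exact: sqr_ge0. Qed.

Lemma continuous_trigsum_sqr w A B n : continuous (fun t => trigsum w A B n t ^+ 2).
Proof. by apply: continuous_sqr; exact: continuous_trigsum. Qed.

(** The weight is at most one, and the constant [p^-1 - 4 p / g^2] left over by
    [ingham_kernel] is positive exactly when [2 p < g], which is
    [pi < L * g]. *)
Lemma observable_gap L g w : 0 < L -> 0 < g -> pi < L * g -> uniform_gap g w ->
  observable L w.
Proof.
move=> L0 g0 Lg wg; pose p := pi / (2 * L).
have p0 : 0 < p by rewrite divr_gt0 ?pi_gt0// mulr_gt0.
have pg : 2 * p < g.
  by rewrite /p (_ : 2 * _ = pi / L) ?ltr_pdivrMr// 1?mulrC//; field; rewrite gt_eqF.
exists (p^-1 - 4 * p / g ^+ 2) => [|A B n].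
  rewrite subr_gt0 ltr_pdivrMr ?exprn_gt0//.
  by rewrite -(ltr_pM2l p0) mulVKf ?gt_eqF//; nra.
have /= := ingham_kernel A B n L0 Lg g0 wg; rewrite -/p ler_norml => /andP[+ _].
move=> h; apply: (@le_trans _ _
   (itg (- L) L (fun t => cos (p * t) * trigsum w A B n t ^+ 2))).
  by rewrite mulrBl; lra.
apply: itg_le.
- by apply: continuous_mul; [cont|exact: continuous_trigsum_sqr].
- exact: continuous_trigsum_sqr.
- by move=> t _; rewrite ler_piMl ?sqr_ge0// cos_le1.
Qed.

Lemma trigsum_upper_bound L g w : 0 < L -> 0 < g -> uniform_gap g w ->
  exists2 C : R, 0 < C & forall A B n,
  itg (- L) L (fun t => trigsum w A B n t ^+ 2) <= C * coef2 A B n.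
Proof.
move=> L0 g0 wg; pose M := 2 * L + 2 * pi / g.
have pi0 := pi_gt0 R.
have M0 : 0 < M by rewrite addr_gt0 ?mulr_gt0 ?invr_gt0.
have LM : 2 * L <= M by rewrite lerDl divr_ge0 ?mulr_ge0// ltW.
have Mg : pi < M * g.
  rewrite /M mulrDl divfK ?gt_eqF//; have : 0 < 2 * L * g by rewrite !mulr_gt0.
  by lra.
pose p := pi / (2 * M).
have p0 : 0 < p by rewrite divr_gt0// mulr_gt0.
have pM : p * M = pi / 2 by rewrite /p; field; rewrite gt_eqF.
(* M exceeds 2 L, which keeps the weight above 1 / 2 on [-L, L] *)
have cos_half t : - L <= t <= L -> 2^-1 <= cos (p * t).
  move=> /andP[tL1 tL2].
  have h1 : 0 <= cos (p * t) by apply: cos_ge0_pihalf; apply/andP; split; nra.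
  have h2 : 0 <= cos (p * t *+ 2) by apply: cos_ge0_pihalf; apply/andP; split; nra.
  by move: h2; rewrite cos_mulr2n; have := cos_le1 (p * t); nra.
exists (2 * (p^-1 + 4 * p / g ^+ 2)) => [|A B n].
  by rewrite mulr_gt0// addr_gt0 ?invr_gt0// divr_gt0 ?exprn_gt0// mulr_gt0.
have /= := ingham_kernel A B n M0 Mg g0 wg; rewrite -/p ler_norml => /andP[_ +].
rewrite lerBlDl -mulrDl => h.
have cf := @continuous_trigsum_sqr w A B n.
suff : 2^-1 * itg (- L) L (fun t => trigsum w A B n t ^+ 2) <=
    itg (- M) M (fun t => cos (p * t) * trigsum w A B n t ^+ 2).
  by rewrite -mulrA; lra.
rewrite -itgZ//; apply: (@le_trans _ _
    (itg (- L) L (fun t => cos (p * t) * trigsum w A B n t ^+ 2))).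
  apply: itg_le; [by cont|by apply: continuous_mul => //; cont|].
  by move=> t tL; rewrite ler_wpM2r ?sqr_ge0// cos_half.
apply: itg_sub_itv; [lra|lra|by apply: continuous_mul => //; cont|].
move=> t /andP[t1 t2]; rewrite mulr_ge0 ?sqr_ge0//.
by apply: cos_ge0_pihalf; apply/andP; split; nra.
Qed.

Lemma observable_single L a : 0 < L -> 0 < a -> exists2 c : R, 0 < c &
  forall A B : R, c * (A ^+ 2 + B ^+ 2) <=
    itg (- L) L (fun t => (A * cos (a * t) + B * sin (a * t)) ^+ 2).
Proof.
move=> L0 a0; have LL : - L <= L by lra.
have aL0 : 0 < 2 * a * L by rewrite !mulr_gt0.
pose S := sin (2 * a * L) / (2 * a).
have SL : `|S| < L.
  rewrite normrM normfV (@gtr0_norm _ (2 * a)) ?mulr_gt0//.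
  by rewrite ltr_pdivrMr ?mulr_gt0// [ltRHS]mulrC norm_sin_lt.
exists (L - `|S|) => [|A B]; first by rewrite subr_gt0.
have cs : continuous (fun t : R => (A * cos (a * t) + B * sin (a * t)) ^+ 2) by cont.
have FE t : - L <= t <= L -> is_derive t 1 (fun t =>
    2^-1 * (A ^+ 2 + B ^+ 2) * t + (A ^+ 2 - B ^+ 2) / (4 * a) * sin (2 * a * t)
    - A * B / (2 * a) * cos (2 * a * t)) ((A * cos (a * t) + B * sin (a * t)) ^+ 2).
  move=> _; der; have -> : 2 * a * t = a * t *+ 2 by ring.
  rewrite sin_mulr2n cos_mulr2n; have := cos2Dsin2 (a * t).
  set c := cos _; set s := sin _ => cs1.
  have s2 : s ^+ 2 = 1 - c ^+ 2 by rewrite -cs1; ring.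
  by rewrite sqrrD !exprMn s2; field; rewrite gt_eqF.
rewrite (itg_ftc LL cs FE) !mulrN sinN cosN.
have SE : sin (2 * a * L) = 2 * a * S by rewrite /S; field; rewrite gt_eqF.
have h : - ((A ^+ 2 + B ^+ 2) * `|S|) <= (A ^+ 2 - B ^+ 2) * S.
  have /ler_normlP[h1 h2] := lexx `|S|.
  by have := sqr_ge0 A; have := sqr_ge0 B; nra.
rewrite SE; apply: (@le_trans _ _ ((A ^+ 2 + B ^+ 2) * L + (A ^+ 2 - B ^+ 2) * S)); first lra.
rewrite le_eqVlt; apply/orP; left; apply/eqP; field; rewrite gt_eqF//.
Qed.

(** Haraux's argument. The second difference
    [f (t + s) + f (t - s) - 2 cos (w_0 s) f t] annihilates the lowest mode and
    multiplies the mode [k] by [2 (cos (w_k s) - cos (w_0 s))]. Averaging over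
    small [s] therefore bounds the higher coefficients by the energy of [f] on
    an interval only slightly longer than [[-L', L']]. The lowest mode is the
    difference of [f] and of a sum that is now under control. *)
Lemma observable_extend L' L g w : 0 < L' -> L' < L -> 0 < w 0%N -> 0 < g ->
  (forall k, w 0%N + g <= w k.+1) -> uniform_gap g (fun k => w k.+1) ->
  observable L' (fun k => w k.+1) -> observable L w.
Proof.
move=> L'0 LL' w0 g0 wg0 wg [c1 c10 obs].
have L0 : 0 < L by exact: lt_trans LL'.
have pi0 := pi_gt0 R.
pose a := w 0%N; pose b := a + g.
have b0 : 0 < b by rewrite addr_gt0.
(* the shifts must keep [-L', L'] inside [-L, L] and satisfy [cos_separation] *)
pose d := Num.min (L - L') (pi / 2 / b).
have d0 : 0 < d by rewrite lt_min subr_gt0 LL'/= !divr_gt0.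
have dL : d <= L - L' by rewrite ge_min lexx.
have bd : b * d <= pi / 2.
  by rewrite mulrC -ler_pdivlMr// ge_min lexx orbT.
have [c2 c20 sep] : exists2 c, 0 < c & forall x, b <= x ->
    c <= itg 0 d (fun s => (cos (x * s) - cos (a * s)) ^+ 2).
  by apply: cos_separation => //; rewrite ltrDl.
have [c3 c30 single] := observable_single L0 w0.
have [C C0 upper] := trigsum_upper_bound L0 g0 wg.
(* 4 c1 c2 coef2 <= 18 d I for the higher modes, see [high] below *)
pose M := 9 * d / (2 * c1 * c2).
have M0 : 0 < M by rewrite divr_gt0 ?mulr_gt0.
have N0 : 0 < (2 + 2 * C * M) / c3 + M.
  have CM : 0 < C * M by rewrite mulr_gt0.
  by rewrite addr_gt0// divr_gt0//; lra.
exists ((2 + 2 * C * M) / c3 + M)^-1 => [|A B n]; first by rewrite invr_gt0.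
rewrite ler_pdivrMl//; case: n => [|n].
  by rewrite /coef2 big_ord0; apply: mulr_ge0; [exact: ltW|exact: trigsum_ge0_itg].
pose f := trigsum w A B n.+1.
pose I := itg (- L) L (fun t => f t ^+ 2).
rewrite -[X in _ <= _ * X]/I.
have I0 : 0 <= I by exact: trigsum_ge0_itg.
have cf : continuous f by exact: continuous_trigsum.
pose A' k := A k.+1; pose B' k := B k.+1; pose w' k := w k.+1.
have fE t : f t = A 0%N * cos (a * t) + B 0%N * sin (a * t) + trigsum w' A' B' n t.
  by rewrite /f /trigsum big_ord_recl.
(* the second difference of step [s], seen from the higher modes *)
have shifted s : 0 <= s <= d ->
    c1 * \sum_(k < n) (4 * (A' k ^+ 2 + B' k ^+ 2)) *
      (cos (w' k * s) - cos (a * s)) ^+ 2 <= 18 * I.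
  move=> /andP[s0 sd].
  pose m k := 2 * (cos (w' k * s) - cos (a * s)).
  have -> : \sum_(k < n) (4 * (A' k ^+ 2 + B' k ^+ 2)) *
      (cos (w' k * s) - cos (a * s)) ^+ 2 =
      coef2 (fun k => m k * A' k) (fun k => m k * B' k) n.
    by apply: eq_bigr => k _; rewrite /m; ring.
  apply: (le_trans (obs _ _ _)).
  have E t : trigsum w' (fun k => m k * A' k) (fun k => m k * B' k) n t =
      f (t + s) + f (t - s) - 2 * cos (a * s) * f t.
    rewrite !fE /trigsum; set X := \sum_(_ < _) _; set Y := \sum_(_ < _) _.
    set Z := \sum_(_ < _) _; set W := \sum_(_ < _) _.
    have -> : X = Y + Z - 2 * cos (a * s) * W.
      rewrite /X /Y /Z /W mulr_sumr -big_split -sumrB/=; apply: eq_bigr => k _.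
      by rewrite !mulrDr !mulrN cosD sinD cosB sinB /m; ring.
    by rewrite !mulrDr !mulrN cosD sinD cosB sinB; ring.
  have cfp : continuous (fun t => f (t + s)).
    by apply: continuous_comp_fun => //; exact: continuous_shift.
  have cfm : continuous (fun t => f (t - s)).
    by apply: continuous_comp_fun => //; exact: continuous_shift.
  (* (x + y - 2 c z)^2 <= 3 (x^2 + y^2 + 4 z^2) as |c| <= 1 *)
  apply: (@le_trans _ _ (itg (- L') L' (fun t =>
     3 * (f (t + s) ^+ 2 + f (t - s) ^+ 2 + 4 * f t ^+ 2)))).
    apply: itg_le; [exact: continuous_trigsum_sqr|by cont|].
    move=> t _; rewrite E; have := cos_max (a * s); rewrite ler_norml => /andP[].
    set c := cos _; set x := f _; set y := f _; set z := f _ => ca cb.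
    have h1 := sqr_ge0 (x - y); have h2 := sqr_ge0 (x + 2 * c * z).
    have h3 := sqr_ge0 (y + 2 * c * z).
    have h4 : c ^+ 2 <= 1 by nra.
    have h5 := sqr_ge0 z.
    by nra.
  have LL : - L' <= L' by lra.
  rewrite itgZ; last by cont.
  rewrite itgD; [|by cont|by cont].
  rewrite itgD; [|by cont|by cont].
  rewrite itgZ; last by cont.
  rewrite (@itg_shift _ (fun t => f t ^+ 2) s _ _ LL); last by cont.
  rewrite (@itg_shift _ (fun t => f t ^+ 2) (- s) _ _ LL); last by cont.
  have cf2 : continuous (fun t => f t ^+ 2) by cont.
  have J x y : - L <= x -> y <= L -> itg x y (fun t => f t ^+ 2) <= I.
    by move=> xL yL; apply: itg_sub_itv => // t _; exact: sqr_ge0.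
  have J1 : itg (- L' + s) (L' + s) (fun t => f t ^+ 2) <= I by apply: J; lra.
  have J2 : itg (- L' - s) (L' - s) (fun t => f t ^+ 2) <= I by apply: J; lra.
  have J3 : itg (- L') L' (fun t => f t ^+ 2) <= I by apply: J; lra.
  by lra.
have high : coef2 A' B' n <= M * I.
  suff : c1 * (c2 * (4 * coef2 A' B' n)) <= 18 * I * d.
    move=> h; rewrite /M mulrAC ler_pdivlMr ?mulr_gt0//; lra.
  have <- : itg 0 d (fun=> 18 * I) = 18 * I * d by rewrite itg_const ?subr0// ltW.
  apply: (@le_trans _ _ (itg 0 d (fun s => c1 * \sum_(k < n)
     (4 * (A' k ^+ 2 + B' k ^+ 2)) * (cos (w' k * s) - cos (a * s)) ^+ 2))); last first.
    by apply: itg_le; [cont|cont|exact: shifted].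
  rewrite itgZ; last by cont.
  rewrite ler_pM2l// itg_sum; last by move=> k; cont.
  rewrite /coef2 !mulr_sumr; apply: ler_sum => k _; rewrite itgZ; last by cont.
  rewrite mulrC ler_wpM2l//; first by rewrite mulr_ge0// addr_ge0// sqr_ge0.
  exact/sep/wg0.
have low : c3 * (A 0%N ^+ 2 + B 0%N ^+ 2) <= (2 + 2 * C * M) * I.
  apply: (le_trans (single _ _)).
  have ct := @continuous_trigsum _ w' A' B' n.
  apply: (@le_trans _ _ (itg (- L) L (fun t =>
      2 * f t ^+ 2 + 2 * trigsum w' A' B' n t ^+ 2))).
    apply: itg_le; [by cont|by cont|move=> t _].
    rewrite fE; set x := _ + _; set y := trigsum _ _ _ _ _.
    by have := sqr_ge0 (x + 2 * y); nra.
  rewrite itgD; [|by cont|by cont].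
  rewrite !itgZ; [|by cont|by cont].
  have := upper A' B' n; have : C * coef2 A' B' n <= C * (M * I) by rewrite ler_pM2l.
  by rewrite -/I; lra.
have -> : coef2 A B n.+1 = (A 0%N ^+ 2 + B 0%N ^+ 2) + coef2 A' B' n.
  by rewrite /coef2 big_ord_recl.
rewrite mulrDl lerD// mulrAC ler_pdivlMr// mulrC; exact: low.
Qed.

(** Without its first [m] modes the sequence has gap [G], which suffices in
    time [L1]. The modes are put back one at a time, each at the cost of half
    of the remaining time [L - L1]. *)
Lemma observable_asymptotic_gap m L1 L g G w : 0 < L1 -> L1 < L -> 0 < g -> 0 < G ->
  uniform_gap g w -> pi < L1 * G -> uniform_gap G (fun k => w (m + k)%N) ->
  observable L w.
Proof.
move=> L10 LL1 g0 G0 wg L1G; elim: m L w LL1 wg => [|m IH] L w LL1 wg wG.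
  have LG : pi < L * G by rewrite (lt_trans L1G)// ltr_pM2r.
  exact: observable_gap (lt_trans L10 LL1) G0 LG wG.
have [wS w0] := wg.
have mono k : g <= w k.+1 - w 0%N.
  have := uniform_gap_sub wg (leq0n k.+1); rewrite subn0 -natr1 mulrDl mul1r.
  have : 0 <= k%:R * g by rewrite mulr_ge0 ?ler0n// ltW.
  by lra.
have wg' : uniform_gap g (fun k => w k.+1).
  by split=> [k|]; [exact: wS|have := mono 0%N; lra].
apply: (@observable_extend ((L1 + L) / 2) L g) => //; try lra.
- by move=> k; have := mono k; lra.
- by apply: IH => //; lra.
Qed.

End Observability.

(** * Energy and zeros for u'' = - (1 + c0 / x^2) u *)

Section Sturm.
Variable R : realType.
Implicit Types (a b x y z M m : R).

Lemma is_derive_gt0_right (f : R -> R) a b d : is_derive a 1 f d -> 0 < d ->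
  a < b -> exists2 y, a < y < b & f a < f y.
Proof.
move=> /is_derive1_caratheodory[g [fg cg ga]] d0 ab.
have g0 : \forall y \near a^'+, 0 < g y.
  by apply: (@cvgr_gt _ _ (a^'+) _ g (g a)); [exact: cvg_at_right_filter|rewrite ga].
near a^'+ => y.
have ay : a < y by near: y; exact: nbhs_right_gt.
have yb : y < b by near: y; exact: nbhs_right_lt.
exists y; first by rewrite ay yb.
by rewrite -subr_gt0 fg mulr_gt0// ?subr_gt0//; near: y.
Unshelve. all: by end_near. Qed.

Variables (c0 : R) (u u1 : R -> R).
Hypothesis uE : forall x, 0 < x -> is_derive x 1 u (u1 x).
Hypothesis u1E : forall x, 0 < x -> is_derive x 1 u1 (- (1 + c0 / x ^+ 2) * u x).

Definition energy x := u x ^+ 2 + u1 x ^+ 2.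

Lemma energy_ge0 x : 0 <= energy x.
Proof. by rewrite addr_ge0 ?sqr_ge0. Qed.

(** Along a solution [|energy'| <= |c0| * energy / x^2], and [|c0| / x^2] has
    the primitive [- |c0| / x], which is bounded at infinity: Gronwall's
    lemma shows that the energy stays between two positive multiples of its
    initial value. *)
Lemma energy_expN_nondecreasing a b : 0 < a -> a <= b ->
  energy a * expR (- (`|c0| / a)) <= energy b * expR (- (`|c0| / b)).
Proof.
move=> a0 ab.
apply: (@ge0_derive_le _ (fun x => energy x * expR (- (`|c0| * x^-1)))
  (fun x => expR (- (`|c0| * x^-1)) *
     ((`|c0| * energy x - 2 * c0 * (u x * u1 x)) / x ^+ 2))) => //.
  move=> x /andP[ax _]; have x0 : 0 < x by exact: lt_le_trans ax.
  have xn : x != 0 by rewrite gt_eqF.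
  have h := uE x0; have h1 := u1E x0.
  by rewrite /energy; der; field.
move=> x /andP[ax _]; have x0 : 0 < x by exact: lt_le_trans ax.
rewrite mulr_ge0 ?expR_ge0// divr_ge0 ?sqr_ge0// /energy.
have := ler_norm c0; have := ler_norm (- c0); rewrite normrN.
have := sqr_ge0 (u x - u1 x); have := sqr_ge0 (u x + u1 x).
by set X := `|c0|; nra.
Qed.

Lemma energy_exp_nonincreasing a b : 0 < a -> a <= b ->
  energy b * expR (`|c0| / b) <= energy a * expR (`|c0| / a).
Proof.
move=> a0 ab.
apply: (@le0_derive_le _ (fun x => energy x * expR (`|c0| * x^-1))
  (fun x => - (expR (`|c0| * x^-1) *
     ((`|c0| * energy x + 2 * c0 * (u x * u1 x)) / x ^+ 2)))) => //.
  move=> x /andP[ax _]; have x0 : 0 < x by exact: lt_le_trans ax.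
  have xn : x != 0 by rewrite gt_eqF.
  have h := uE x0; have h1 := u1E x0.
  by rewrite /energy; der; field.
move=> x /andP[ax _]; have x0 : 0 < x by exact: lt_le_trans ax.
rewrite oppr_le0 mulr_ge0 ?expR_ge0// divr_ge0 ?sqr_ge0// /energy.
have := ler_norm c0; have := ler_norm (- c0); rewrite normrN.
have := sqr_ge0 (u x - u1 x); have := sqr_ge0 (u x + u1 x).
by set X := `|c0|; nra.
Qed.

Lemma energy_ge a x : 0 < a -> a <= x ->
  energy a * expR (- (`|c0| / a)) <= energy x.
Proof.
move=> a0 ax; apply: (le_trans (energy_expN_nondecreasing a0 ax)).
rewrite ler_piMr ?energy_ge0// -expR0 ler_expR oppr_le0 divr_ge0//.
by rewrite ltW// (lt_le_trans a0).
Qed.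

Lemma energy_le a x : 0 < a -> a <= x ->
  energy x <= energy a * expR (`|c0| / a).
Proof.
move=> a0 ax; apply: le_trans (energy_exp_nonincreasing a0 ax).
rewrite ler_peMr ?energy_ge0// -expR0 ler_expR divr_ge0//.
by rewrite ltW// (lt_le_trans a0).
Qed.

(** Sturm comparison with [v x = cos (M * (x - c))], where [c] is the midpoint
    of [a] and [b]. If [b - a] were less than [pi / M], then [v] would be
    positive on the interval, and [P = u u' - u^2 v' / v] would be
    nondecreasing by Picone's identity; but [P] vanishes at both ends and
    increases strictly at [a]. *)
Lemma zero_gap a b M : 0 < a -> a < b -> u a = 0 -> u b = 0 -> 0 < M ->
  (forall x, a <= x <= b -> 1 + c0 / x ^+ 2 <= M ^+ 2) -> 0 < energy a ->
  pi <= M * (b - a).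
Proof.
move=> a0 ab ua ub M0 QM Ea; rewrite leNgt; apply/negP => Mab.
pose c := (a + b) / 2.
have v0 x : a <= x <= b -> 0 < cos (M * (x - c)).
  by move=> /andP[ax xb]; apply: cos_gt0_pihalf; apply/andP; rewrite /c; split; nra.
pose s x := sin (M * (x - c)) / cos (M * (x - c)).
pose P x := u x * u1 x + M * (u x ^+ 2 * (sin (M * (x - c)) * (cos (M * (x - c)))^-1)).
pose dP x := (u1 x + M * (u x * s x)) ^+ 2 + (M ^+ 2 - (1 + c0 / x ^+ 2)) * u x ^+ 2.
have PE x : a <= x <= b -> is_derive x 1 P (dP x).
  move=> xab; have x0 : 0 < x by case/andP: xab => ax _; exact: lt_le_trans ax.
  have xn : x != 0 by rewrite gt_eqF.
  have vn : cos (M * (x - c)) != 0 by rewrite gt_eqF// v0.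
  have h := uE x0; have h1 := u1E x0.
  rewrite /P; der; rewrite /dP /s.
  have := cos2Dsin2 (M * (x - c)); move: vn.
  set C := cos _; set S := sin _ => Cn CS.
  have S2 : S ^+ 2 = 1 - C ^+ 2 by rewrite -CS; ring.
  by field: S2; rewrite xn.
have dP0 x : a <= x <= b -> 0 <= dP x.
  by move=> xab; rewrite addr_ge0 ?sqr_ge0// mulr_ge0 ?sqr_ge0// subr_ge0 QM.
have Pa : P a = 0 by rewrite /P ua; ring.
have Pb : P b = 0 by rewrite /P ub; ring.
have aab : a <= a <= b by rewrite lexx ltW.
have dPa : 0 < dP a.
  by move: Ea; rewrite /dP /energy ua mul0r mulr0 addr0 expr0n/= add0r mulr0 addr0.
have [y /andP[ay yb] Py] := is_derive_gt0_right (PE _ aab) dPa ab.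
have : P y <= P b.
  apply: (@ge0_derive_le _ P dP) => [|x /andP[yx xb]|x /andP[yx xb]]; first exact: ltW.
    by apply: PE; rewrite xb (le_trans (ltW ay)).
  by apply: dP0; rewrite xb (le_trans (ltW ay)).
by rewrite Pb leNgt -Pa Py.
Qed.

(** If [u] had no zero, [atan (u' / (m u)) + m x] would be nonincreasing, so
    that over a length [pi / m] the arctangent would drop by at least [pi],
    more than the width of its open range allows. *)
Lemma zero_exists a m : 0 < a -> 0 < m ->
  (forall x, a <= x -> m ^+ 2 <= 1 + c0 / x ^+ 2) ->
  exists2 z, a <= z & u z = 0.
Proof.
move=> a0 m0 Qm; apply: contrapT => H.
have un x : a <= x -> u x != 0.
  by move=> ax; apply/eqP => ux; apply: H; exists x.
pose b := a + pi / m.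
have ab : a <= b by rewrite lerDl divr_ge0 ?pi_ge0// ltW.
pose r x := u1 x * (m * u x)^-1.
have : atan (r b) + m * b <= atan (r a) + m * a.
  apply: (@le0_derive_le _ (fun x => atan (u1 x * (m * u x)^-1) + m * x)
    (fun x => m^-1 * (m ^+ 2 - (1 + c0 / x ^+ 2)) / (1 + r x ^+ 2))) => //.
    move=> x /andP[ax _]; have x0 : 0 < x by exact: lt_le_trans ax.
    have xn : x != 0 by rewrite gt_eqF.
    have h := uE x0; have h1 := u1E x0; have ux := un _ ax.
    have mn : m != 0 by rewrite gt_eqF.
    have mu0 : m * u x != 0 by rewrite mulf_neq0.
    have rn : (m * u x) ^+ 2 + u1 x ^+ 2 != 0.
      by rewrite gt_eqF// ltr_wpDr ?sqr_ge0// exprn_even_gt0.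
    by der; rewrite /r; field; rewrite ux mn rn xn.
  move=> x /andP[ax _]; rewrite mulr_le0_ge0//; last first.
    by rewrite invr_ge0 addr_ge0 ?sqr_ge0.
  rewrite pmulr_rle0 ?invr_gt0// subr_le0; exact: Qm.
rewrite /b mulrDr mulrCA mulfV ?gt_eqF// mulr1.
have := atan_ltpi2 (r a); have := atan_gtNpi2 (r b).
by move: (atan _) (atan _) => p q; lra.
Qed.

End Sturm.

(** * Euler's integral *)

Section GammaFunction.
Variable R : realType.
Implicit Types (p s t : R).
Local Notation mu := (@lebesgue_measure R).

(** The integrand of [Gamma (p + 1)], continuous up to the origin for [p >= 0],
    the range in which Bessel functions of order [nu >= 0] take it. *)
Definition gammaf p t : R := t `^ p * expR (- t).

Lemma gammaf_ge0 p t : 0 <= gammaf p t.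
Proof. by rewrite mulr_ge0 ?powR_ge0// expR_ge0. Qed.

Lemma is_derive_gammaf p t : 0 < t ->
  is_derive t 1 (gammaf p) (p * gammaf (p - 1) t - gammaf p t).
Proof. by move=> t0; rewrite /gammaf; der; ring. Qed.

Lemma gammaf_continuous p : 0 <= p -> {within `[0, +oo[, continuous (gammaf p)}.
Proof.
move=> p0; apply/continuous_within_itvcyP; split.
  move=> t; rewrite in_itv/= andbT => t0.
  exact: is_derive_cvg (is_derive_gammaf p t0).
apply: cvgM; last first.
  apply: cvg_at_right_filter.
  have h : is_derive (0 : R) 1 (fun t => expR (- t)) (- expR (- 0)) by der; ring.
  exact: is_derive_cvg h.
have [->|pn] := eqVneq p 0.
  have -> : (fun t : R => t `^ 0) = fun=> 1 by apply/funext => t; rewrite powRr0.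
  by rewrite powRr0; exact: cvg_cst.
by rewrite powR0//; apply: powR_cvg0; rewrite lt_neqAle eq_sym pn.
Qed.

Lemma gammaf_bound p : 0 <= p ->
  exists2 C, 0 < C & forall t, 0 <= t -> gammaf p t <= C * expR (- (t / 2)).
Proof.
move=> p0; pose n := Num.bound p.
(* [t^p <= (t + 1)^(n + 1)], and the exponential of [(t + 1) / 2] is at least
   the term of degree [n + 1] of its series *)
pose C : R := 2 ^+ n.+1 * n.+1`!%:R * expR (1 / 2).
have f0 : 0 < n.+1`!%:R :> R by rewrite ltr0n fact_gt0.
have C0 : 0 < C.
  by apply: mulr_gt0 (expR_gt0 _); apply: mulr_gt0 => //; exact: exprn_gt0.
exists C => // t t0.
have pn : p <= n.+1%:R.
  by rewrite (le_trans (ltW (archi_boundP p0)))// ler_nat.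
have h1 : t `^ p <= (t + 1) ^+ n.+1.
  apply: (@le_trans _ _ ((t + 1) `^ p)).
    by rewrite ge0_ler_powR// ?nnegrE ?addr_ge0// lerDl.
  by rewrite -powR_mulrn ?addr_ge0// ler_powR// lerDr.
have h2 : (t + 1) ^+ n.+1 <= C * expR (t / 2).
  have y0 : 0 <= (t + 1) / 2 by rewrite divr_ge0// addr_ge0.
  have := expR_ge1Dxn n y0; set y := (t + 1) / 2 => hy.
  have -> : t + 1 = 2 * y by rewrite /y; field.
  have -> : C * expR (t / 2) = 2 ^+ n.+1 * (n.+1`!%:R * expR y).
    have -> : y = 1 / 2 + t / 2 by rewrite /y; field.
    by rewrite expRD /C; ring.
  rewrite exprMn ler_pM2l ?exprn_gt0// mulrC -ler_pdivrMr//.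
  by apply: le_trans hy; rewrite lerDr.
rewrite /gammaf; apply: (@le_trans _ _ (C * expR (t / 2) * expR (- t))).
  by rewrite ler_pM2r ?expR_gt0// (le_trans h1).
by rewrite -mulrA -expRD (_ : t / 2 - t = - (t / 2))//; field.
Qed.

Lemma expR_half_cvg (C : R) : C * expR (- (t / 2)) @[t --> +oo] --> 0.
Proof.
have h : expR (- (t / 2)) @[t --> (+oo : set_system R)] --> (0 : R).
  apply: (@cvg_comp _ _ _ (fun t : R => t / 2) (fun t => expR (- t)) _ (+oo : set_system R)).
    by apply: gt0_cvgMly => //; exact: cvg_id.
  exact: cvgr_expR.
by rewrite -[X in _ --> X](mulr0 C); apply: cvgM => //; exact: cvg_cst.
Qed.

Lemma gammaf_cvg0 p : 0 <= p -> gammaf p t @[t --> +oo] --> 0.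
Proof.
move=> p0; have [C C0 gC] := gammaf_bound p0.
apply: (@squeeze_cvgr _ _ _ _ (fun=> 0) (fun t => C * expR (- (t / 2)))).
- by near=> t; rewrite gammaf_ge0/= gC.
- exact: cvg_cst.
- exact: expR_half_cvg.
Unshelve. all: by end_near. Qed.

Lemma integrable_gammaf p : 0 <= p -> mu.-integrable `[0, +oo[ (EFin \o gammaf p).
Proof.
move=> p0; have [C C0 gC] := gammaf_bound p0.
have mg : measurable_fun (`[0, +oo[ : set R) (gammaf p).
  by apply: subspace_continuous_measurable_fun => //; exact: gammaf_continuous.
apply/integrableP; split; first exact/measurable_EFinP.
have eE (K t : R) : is_derive t 1 (fun t => K * expR (- (t / 2)))
    (- (K / 2) * expR (- (t / 2))) by der; field.
have ce : continuous (fun t : R => C * expR (- (t / 2))).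
  by move=> t; exact: is_derive_cvg (eE C t).
apply: (@le_lt_trans _ _ (\int[mu]_(t in `[0%R, +oo[) (C * expR (- (t / 2)))%:E)%E).
  apply: ge0_le_integral => //.
  - exact/measurableT_comp/measurable_EFinP.
  - by apply/measurable_EFinP/measurable_funTS; exact: continuous_measurable_fun.
  - move=> t /=; rewrite in_itv/= andbT => t0.
    by rewrite lee_fin ger0_norm ?gammaf_ge0// gC.
rewrite (@ge0_continuous_FTC2y _ _ (fun t => - (2 * C) * expR (- (t / 2))) _ 0).
- by rewrite sub0e -EFinN ltry.
- by move=> t t0; rewrite mulr_ge0 ?expR_ge0// ltW.
- exact: continuous_subspaceT.
- exact: expR_half_cvg.
- by move=> t _; case: (eE (- (2 * C)) t).
- by apply: cvg_at_right_filter; exact: is_derive_cvg (eE _ _).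
- by move=> t _; rewrite (is_derive_val (eE _ _)); field.
Qed.

Local Notation itg0y f := (\int[mu]_(t in `[0, +oo[) f t).

(** Integration by parts: the derivative of [gammaf (p + 1)], which vanishes at
    both ends, is [(p + 1) * gammaf p - gammaf (p + 1)]. *)
Lemma gammaf_integralS p : 0 <= p ->
  itg0y (gammaf (p + 1)) = (p + 1) * itg0y (gammaf p).
Proof.
move=> p0; have p10 : 0 <= p + 1 by rewrite addr_ge0.
have p1 : 0 < p + 1 by rewrite ltr_wpDl.
have i0 := integrable_gammaf p0; have i1 := integrable_gammaf p10.
pose s := p + 1; pose g t := s * gammaf p t - gammaf s t.
have i0' : mu.-integrable `[0, +oo[ (EFin \o (fun t => s * gammaf p t)).
  exact: (integrableZl _ s i0).
have ig : mu.-integrable `[0, +oo[ (EFin \o g).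
  exact: (integrableB _ i0' i1).
have gE t : 0 < t -> is_derive t 1 (gammaf s) (g t).
  by move=> t0; apply: is_derive_eq (is_derive_gammaf s t0) _; rewrite /s addrK.
have cg : {within `[0, +oo[, continuous g}.
  move=> x; apply: cvgB; last exact: gammaf_continuous.
  by apply: cvgM; [exact: cvg_cst|exact: gammaf_continuous].
have s0 : gammaf s 0 = 0 by rewrite /gammaf powR0 ?mul0r// gt_eqF.
have gs_cvg a : 0 <= a -> gammaf s t @[t --> a^'+] --> gammaf s a.
  rewrite le_eqVlt => /predU1P[<-|a0].
    by have /continuous_within_itvcyP[] := gammaf_continuous p10.
  by apply: cvg_at_right_filter; exact: is_derive_cvg (gE _ a0).
(* [g] is nonpositive beyond [s], so the fundamental theorem of calculus for
   integrands of constant sign applies on the unbounded part *)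
have E1 : \int[mu]_(t in `[0, s]) g t = gammaf s s.
  rewrite /Rintegral (@continuous_FTC2 _ _ (gammaf s))//.
  - by rewrite s0 sube0.
  - by apply: continuous_subspaceW cg; apply: subset_itvl.
  - split.
    + by move=> t; rewrite in_itv/= => /andP[t0 _]; case: (gE _ t0).
    + exact: gs_cvg.
    + by apply: cvg_at_left_filter; exact: is_derive_cvg (gE _ p1).
  - by move=> t; rewrite in_itv/= => /andP[t0 _]; exact: is_derive_val (gE _ t0).
have cgs : {within `[s, +oo[, continuous g}.
  by apply: continuous_subspaceW cg; apply: subset_itvr; rewrite bnd_simp ltW.
have E2 : \int[mu]_(t in `[s, +oo[) (- g t) = gammaf s s.
  rewrite (@Rintegral_ge0_continuous_FTC2y _ _ (fun t => - gammaf s t) _ 0).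
  - by rewrite sub0r opprK.
  - move=> t st; have t0 : 0 < t by exact: lt_le_trans st.
    have ts : t `^ s = t * t `^ p by rewrite -(mulr_powRB1 (ltW t0) p1) addrK.
    rewrite /g /gammaf ts opprB subr_ge0 mulrA ler_pM2r ?expR_gt0//.
    by rewrite ler_wpM2r ?powR_ge0.
  - by move=> x; apply: cvgN; exact: cgs.
  - by rewrite -oppr0; apply: cvgN; exact: gammaf_cvg0.
  - by move=> t st; apply: derivableN; case: (gE _ (lt_trans p1 st)).
  - by apply: cvgN; apply: gs_cvg; exact: ltW.
  - move=> t; rewrite in_itv/= andbT => st.
    exact: is_derive_val (is_derive_opp (gE _ (lt_trans p1 st))).
have : itg0y g = 0.
  have iy : mu.-integrable `[s, +oo[ (EFin \o g).
    by apply: integrableS ig => //; apply: subset_itvr; rewrite bnd_simp ltW.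
  have := @Rintegral_itvB _ g (BLeft 0) +oo%O s ig; rewrite bnd_simp => /(_ (ltW p1) isT).
  rewrite E1 Rintegral_itv_obnd_cbnd; last first.
    by apply: integrableS iy => //; apply: subset_itvr; rewrite bnd_simp.
  have E3 : gammaf s s = -1 * \int[mu]_(t in `[s, +oo[) g t.
    rewrite -E2 -RintegralZl//.
    by apply: eq_Rintegral => t _; rewrite mulN1r.
  by rewrite E3; lra.
rewrite /g RintegralB// RintegralZl// -/s => /eqP.
by rewrite subr_eq0 => /eqP ->.
Qed.

Lemma GammaE s : 1 <= s -> Gamma s = itg0y (gammaf (s - 1)).
Proof.
move=> s1; rewrite /Gamma Rintegral_itv_obnd_cbnd//.
apply: integrableS (integrable_gammaf (p := s - 1) _) => //; last by rewrite subr_ge0.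
by apply: subset_itvr; rewrite bnd_simp.
Qed.

Lemma GammaS s : 1 <= s -> Gamma (s + 1) = s * Gamma s :> R.
Proof.
move=> s1; have s0 : 0 <= s - 1 by rewrite subr_ge0.
rewrite !GammaE//; last by rewrite (le_trans s1)// lerDl.
by have := gammaf_integralS s0; rewrite subrK addrK.
Qed.

Lemma Gamma_gt0 s : 1 <= s -> 0 < Gamma s :> R.
Proof.
move=> s1; have s0 : 0 <= s - 1 by rewrite subr_ge0.
rewrite GammaE//; set p := s - 1.
apply: (@lt_le_trans _ _ (expR (- 2))); first exact: expR_gt0.
have <- : \int[mu]_(t in `[1, 2]) (expR (-2) : R) = expR (-2).
  by rewrite itg_const ?ler1n//; ring.
apply: (@le_trans _ _ (\int[mu]_(t in `[1, 2]) gammaf p t)).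
  apply: le_Rintegral => //.
  - by apply: continuous_integrable; exact: continuous_const.
  - apply: integrableS (integrable_gammaf s0) => //.
    by move=> t /=; rewrite !in_itv/= andbT => /andP[/(le_trans ler01)].
  - move=> t /=; rewrite in_itv/= => /andP[t1 t2].
    rewrite -[leLHS]mul1r /gammaf; apply: ler_pM; rewrite ?expR_ge0//.
      by rewrite -[leLHS](powRr0 t) ler_powR.
    by rewrite ler_expR lerN2.
apply: fine_le.
- apply: integrable_fin_num => //; apply: integrableS (integrable_gammaf s0) => //.
  by move=> t /=; rewrite !in_itv/= andbT => /andP[/(le_trans ler01)].
- by apply: integrable_fin_num => //; exact: integrable_gammaf.
apply: ge0_subset_integral => //.
- by have /integrableP[] := integrable_gammaf s0.
- by move=> t _; rewrite lee_fin gammaf_ge0.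
- by move=> t /=; rewrite !in_itv/= andbT => /andP[/(le_trans ler01)].
Qed.

End GammaFunction.

(** * The power series of Bessel functions *)

(* Only the functional equation and the sign of [Gamma] matter from here on. *)
Opaque Gamma.

Section BesselSeries.
Variable R : realType.
Implicit Types (nu x y : R) (m n : nat).

Definition besselG_coef nu m : R :=
  (-1) ^+ m / (m`!%:R * Gamma (m%:R + nu + 1)).

(** The entire function such that [J_nu x = (x / 2)^nu * besselG nu (x^2 / 4)]
    ([besselJE]). It isolates the singularity of [J_nu] at the origin in a
    power of [x]. *)
Definition besselG nu y : R := limn (pseries (besselG_coef nu) y).

Lemma Gamma_shift_ge nu m : 0 <= nu ->
  Gamma (nu + 1) <= Gamma (m%:R + nu + 1) :> R.
Proof.
move=> nu0; elim: m => [|m IH]; first by rewrite add0r.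
have m1 : 1 <= m%:R + nu + 1 by rewrite lerDr addr_ge0.
have -> : m.+1%:R + nu + 1 = (m%:R + nu + 1) + 1 by rewrite -natr1; ring.
rewrite (GammaS m1); apply: (le_trans IH).
by rewrite ler_peMl//; apply/ltW/Gamma_gt0.
Qed.

(** As [Gamma (m + nu + 1) >= Gamma (nu + 1)], the exponential series
    dominates. *)
Lemma is_cvg_besselG nu y : 0 <= nu -> cvgn (pseries (besselG_coef nu) y).
Proof.
move=> nu0; apply: normed_cvg.
have G0 : 0 < Gamma (nu + 1) :> R by rewrite Gamma_gt0// lerDr.
apply: (@series_le_cvg _ _ (fun n => (Gamma (nu + 1))^-1 * exp_coeff `|y| n)).
- by move=> n /=.
- by move=> n; apply: mulr_ge0; [rewrite invr_ge0 ltW|exact: exp_coeff_ge0].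
- move=> n; rewrite /besselG_coef /exp_coeff/= !normrM normrX normrN1 expr1n mul1r.
  rewrite normfV normrX normrM (@ger0_norm _ n`!%:R)// invfM mulrAC [leRHS]mulrC.
  rewrite [X in X / _]mulrC ler_wpM2l ?mulr_ge0 ?invr_ge0//.
  have Gn : 0 < Gamma (n%:R + nu + 1) :> R by rewrite Gamma_gt0// lerDr addr_ge0.
  by rewrite (gtr0_norm Gn) (lef_pV2 Gn G0); exact: Gamma_shift_ge.
- exact: (@is_cvg_seriesZ _ _ (Gamma (nu + 1))^-1 (is_cvg_series_exp_coeff `|y|)).
Qed.

Lemma besselG_coef_diffs nu : pseries_diffs (besselG_coef nu) = - besselG_coef (nu + 1).
Proof.
apply/funext => m; rewrite /pseries_diffs [RHS]/(- besselG_coef _ _) /besselG_coef.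
have -> : m.+1%:R + nu + 1 = m%:R + (nu + 1) + 1 by rewrite -natr1; ring.
rewrite factS natrM exprS mulN1r mulNr mulrN -mulrA; congr (- _).
by rewrite invfM [X in _ * X]mulrCA mulVKf// pnatr_eq0.
Qed.

Lemma is_derive_besselG nu y : 0 <= nu ->
  is_derive y 1 (besselG nu) (- besselG (nu + 1) y).
Proof.
move=> nu0; have nu1 : 0 <= nu + 1 by rewrite addr_ge0.
have nu2 : 0 <= nu + 1 + 1 by rewrite addr_ge0.
have N (c : R^nat) (x : R) : pseries (- c) x = - pseries c x.
  apply/funext => n; have E (d : R^nat) : pseries d x n = \sum_(0 <= i < n) d i * x ^+ i by [].
  transitivity (- pseries c x n); last by [].
  by rewrite !E (eq_bigr (fun i => - (c i * x ^+ i))) ?sumrN// => i _; rewrite mulNr.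
have -> : - besselG (nu + 1) y = limn (pseries (pseries_diffs (besselG_coef nu)) y).
  by rewrite besselG_coef_diffs N limN//; exact: is_cvg_besselG.
apply: (@pseries_snd_diffs _ _ (`|y| + 1)).
- exact: is_cvg_besselG.
- by rewrite besselG_coef_diffs N; apply: is_cvgN; exact: is_cvg_besselG.
- rewrite besselG_coef_diffs pseries_diffsN besselG_coef_diffs opprK.
  exact: is_cvg_besselG.
- by rewrite [ltRHS]ger0_norm ?addr_ge0// ltrDl.
Qed.

Lemma besselG_coefS nu n : 0 <= nu ->
  besselG_coef nu n.+1 - (nu + 1) * besselG_coef (nu + 1) n.+1
    + besselG_coef (nu + 1 + 1) n = 0.
Proof.
move=> nu0; rewrite /besselG_coef exprS factS natrM -natr1.
have -> : n%:R + (nu + 1 + 1) + 1 = (n%:R + nu + 1 + 1) + 1 by ring.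
have -> : n%:R + 1 + (nu + 1) + 1 = (n%:R + nu + 1 + 1) + 1 by ring.
have -> : n%:R + 1 + nu + 1 = n%:R + nu + 1 + 1 by ring.
have s1 : 1 <= n%:R + nu + 1 + 1 by rewrite lerDr !addr_ge0.
rewrite (GammaS s1).
have : 0 < n`!%:R :> R by rewrite ltr0n fact_gt0.
have : 0 <= n%:R :> R by [].
have : 0 < Gamma (n%:R + nu + 1 + 1) :> R by rewrite Gamma_gt0.
move: (Gamma _) => g; move: (n`!%:R : R) (n%:R : R) ((-1) ^+ n : R) => f k e g0 k0 f0.
have k1 : 0 < k + 1 by rewrite ltr_wpDl.
have kn : 0 < k + nu + 1 + 1 by clear s1; lra.
by field; rewrite !gt_eqF.
Qed.

(** Bessel's equation: since the derivative of [besselG nu] is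
    [- besselG (nu + 1)], this reads [y G'' + (nu + 1) G' + G = 0]. *)
Lemma besselG_recurrence nu y : 0 <= nu ->
  besselG nu y - (nu + 1) * besselG (nu + 1) y + y * besselG (nu + 1 + 1) y = 0.
Proof.
move=> nu0; have nu1 : 0 <= nu + 1 by rewrite addr_ge0.
have nu2 : 0 <= nu + 1 + 1 by rewrite addr_ge0.
pose S nu n := pseries (besselG_coef nu) y n.
have C nu' : 0 <= nu' -> S nu' @ \oo --> besselG nu' y.
  by move=> h; exact: is_cvg_besselG.
have C1 nu' : 0 <= nu' -> (fun n => S nu' n.+1) @ \oo --> besselG nu' y.
  by move=> h; have := C _ h; rewrite -[X in X -> _](@cvg_shiftS _ (S nu')).
have E n : S nu n.+1 - (nu + 1) * S (nu + 1) n.+1 + y * S (nu + 1 + 1) n = 0.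
  elim: n => [|n IH].
    have S1 nu' : S nu' 1%N = (Gamma (nu' + 1))^-1.
      rewrite /S /pseries seriesEnat/= big_nat1 /besselG_coef expr0 fact0 mulr1.
      by rewrite !mul1r add0r.
    have -> : S (nu + 1 + 1) 0%N = 0 by rewrite /S /pseries seriesEnat/= big_geq.
    have g1 : 1 <= nu + 1 by rewrite lerDr.
    rewrite !S1 (GammaS g1) mulr0 addr0.
    have G0 : 0 < Gamma (nu + 1) :> R by rewrite Gamma_gt0// lerDr.
    move: G0; move: (Gamma _) => g G0.
    by field; rewrite gt_eqF//= gt_eqF// ltr_wpDl.
  have SS nu' k : S nu' k.+1 = S nu' k + besselG_coef nu' k * y ^+ k.
    by rewrite /S /pseries /series/= big_nat_recr.
  rewrite SS (SS (nu + 1)) (SS (nu + 1 + 1)).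
  have -> : S nu n.+1 + besselG_coef nu n.+1 * y ^+ n.+1 -
     (nu + 1) * (S (nu + 1) n.+1 + besselG_coef (nu + 1) n.+1 * y ^+ n.+1) +
     y * (S (nu + 1 + 1) n + besselG_coef (nu + 1 + 1) n * y ^+ n) =
     (S nu n.+1 - (nu + 1) * S (nu + 1) n.+1 + y * S (nu + 1 + 1) n) +
     y ^+ n.+1 * (besselG_coef nu n.+1 - (nu + 1) * besselG_coef (nu + 1) n.+1
       + besselG_coef (nu + 1 + 1) n).
    rewrite exprS; move: (S nu _) (S (nu + 1) _) (S (nu + 1 + 1) _) (y ^+ n).
    by move: (besselG_coef nu _) (besselG_coef (nu + 1) _) (besselG_coef (nu + 1 + 1) _) => *; ring.
  by rewrite IH add0r (besselG_coefS n nu0) mulr0.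
have : (fun n => S nu n.+1 - (nu + 1) * S (nu + 1) n.+1 + y * S (nu + 1 + 1) n) @ \oo
    --> besselG nu y - (nu + 1) * besselG (nu + 1) y + y * besselG (nu + 1 + 1) y.
  apply: cvgD; last by apply: cvgM; [exact: cvg_cst|exact: C].
  by apply: cvgB; [exact: C1|apply: cvgM; [exact: cvg_cst|exact: C1]].
rewrite (_ : (fun n => _) = fun=> 0); last by apply/funext => n; exact: E.
by move=> /cvg_lim <-//; rewrite lim_cst.
Qed.

Lemma besselG0 nu : besselG nu 0 = (Gamma (nu + 1))^-1.
Proof.
apply: cvg_lim => //; rewrite -(@cvg_shiftS _ (pseries _ _)).
rewrite [X in X @ _ --> _](_ : _ = fun=> (Gamma (nu + 1))^-1); first exact: cvg_cst.
apply/funext => n; rewrite /pseries /series/= big_nat_recl//= big1 => [|i _].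
  by rewrite /besselG_coef !expr0 fact0 !mul1r mulr1 addr0 add0r.
by rewrite expr0n mulr0.
Qed.

Lemma besselJE nu x : 0 <= nu -> 0 < x ->
  besselJ nu x = 2 `^ (- nu) * (x `^ nu * besselG nu (4^-1 * x ^+ 2)).
Proof.
move=> nu0 x0; rewrite /besselJ /besselG.
have x20 : 0 < x / 2 by rewrite divr_gt0.
rewrite (_ : series _ = (2 `^ (- nu) * x `^ nu) *: pseries (besselG_coef nu) (4^-1 * x ^+ 2)).
  rewrite limZl_tmp; last exact: is_cvg_besselG.
  by rewrite mulrA.
apply/funext => n; transitivity ((2 `^ (- nu) * x `^ nu) *
  \sum_(0 <= m < n) besselG_coef nu m * (4^-1 * x ^+ 2) ^+ m); last by [].
rewrite seriesEnat/= mulr_sumr; apply: eq_bigr => m _; rewrite /besselG_coef.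
have -> : (x / 2) `^ ((2 * m)%:R + nu) =
    (4^-1 * x ^+ 2) ^+ m * (2 `^ (- nu) * x `^ nu).
  rewrite powRD; last by rewrite (gt_eqF x20) implybT.
  congr (_ * _).
    rewrite powR_mulrn; last exact: ltW.
    by rewrite exprM; congr (_ ^+ _); field.
  rewrite powRM; [|exact: ltW|by rewrite invr_ge0].
  by rewrite mulrC -(@powR_inv1 _ 2)// -powRrM mulN1r.
by move: (Gamma _) (4^-1 * _) => g z; ring.
Qed.

End BesselSeries.

(** * The normal form of Bessel's equation *)

(* From here on [besselG] is used through its derivative, its recurrence and its
   value at the origin. *)
Opaque besselG.

Section BesselODE.
Variable R : realType.
Variable nu : R.
Hypothesis nu0 : 0 <= nu.
Implicit Types (x y z : R) (k n : nat).

Let nu1 : 0 <= nu + 1. Proof. by rewrite addr_ge0. Qed.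

(** [sqrt x * J_nu x] up to the constant [2^nu]: Liouville's substitution, which
    removes the first-order term from Bessel's equation. *)
Definition besselU x : R := x `^ (nu + 2^-1) * besselG nu (4^-1 * x ^+ 2).

Definition besselU1 x : R :=
  (nu + 2^-1) * x `^ (nu + 2^-1 - 1) * besselG nu (4^-1 * x ^+ 2)
  - 2^-1 * x * x `^ (nu + 2^-1) * besselG (nu + 1) (4^-1 * x ^+ 2).

Lemma powR_pred x p : 0 < x -> x `^ p = x * x `^ (p - 1).
Proof.
move=> x0; have -> : x * x `^ (p - 1) = x `^ 1 * x `^ (p - 1).
  by rewrite powRr1// ltW.
by rewrite -powRD ?(gt_eqF x0) ?implybT//; congr (_ `^ _); ring.
Qed.

Lemma is_derive_besselU x : 0 < x -> is_derive x 1 besselU (besselU1 x).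
Proof.
move=> x0; have h := is_derive_besselG (4^-1 * x ^+ 2) nu0.
rewrite /besselU /besselU1; der.
by move: (besselG _ _) (besselG _ _) => a b; field.
Qed.

Lemma is_derive_besselU1 x : 0 < x ->
  is_derive x 1 besselU1 (- (1 + (4^-1 - nu ^+ 2) / x ^+ 2) * besselU x).
Proof.
move=> x0; have h := is_derive_besselG (4^-1 * x ^+ 2) nu0.
have h1 := is_derive_besselG (4^-1 * x ^+ 2) nu1.
have rec := besselG_recurrence (4^-1 * x ^+ 2) nu0.
rewrite /besselU1 /besselU; move: h h1 rec.
move: (besselG nu) (besselG (nu + 1)) (besselG (nu + 1 + 1)) => A B C h h1 rec; der.
rewrite (powR_pred (nu + 2^-1) x0) (powR_pred (nu + 2^-1 - 1) x0).
move: rec; move: (A _) (B _) (C _) => a b c rec.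
have -> : a = (nu + 1) * b - 4^-1 * x ^+ 2 * c by rewrite -[LHS]subr0 -rec; ring.
move: (x `^ _) => X; field; rewrite gt_eqF//.
Qed.

Lemma besselJ_U x : 0 < x -> besselJ nu x = 2 `^ (- nu) * (x `^ (- 2^-1) * besselU x).
Proof.
move=> x0; rewrite besselJE// /besselU.
have <- : x `^ (- 2^-1) * x `^ (nu + 2^-1) = x `^ nu.
  by rewrite -powRD ?(gt_eqF x0) ?implybT//; congr (_ `^ _); ring.
by move: (besselG _ _) (x `^ _) (x `^ _) (2 `^ _) => *; ring.
Qed.

Lemma besselJ_eq0 x : 0 < x -> (besselJ nu x == 0) = (besselU x == 0).
Proof.
move=> x0; rewrite besselJ_U// !mulf_eq0 (gt_eqF (powR_gt0 _ _))//=.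
by rewrite gt_eqF ?powR_gt0.
Qed.

(** At a zero, differentiating the factor [x^(- 1 / 2)] contributes nothing. *)
Lemma derive1_besselJ z : 0 < z -> besselJ nu z = 0 ->
  derive1 (besselJ nu) z = 2 `^ (- nu) * (z `^ (- 2^-1) * besselU1 z).
Proof.
move=> z0 /eqP; rewrite besselJ_eq0// => /eqP Uz.
apply: is_derive_val.
apply: (@near_eq_is_derive _ _ _ (fun x => 2 `^ (- nu) * (x `^ (- 2^-1) * besselU x))).
  near=> x; rewrite besselJ_U//; near: x; exact: lt_nbhsr.
have h := is_derive_besselU z0.
by der; rewrite Uz; ring.
Unshelve. all: by end_near. Qed.

(** Near the origin the equation is singular and the energy estimates fail. The
    lower bound keeps the zeros away from that region, the upper bound controls
    [besselG] inside it. *)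
Lemma besselG_gt0_near0 : exists2 x0 : R, 0 < x0 &
  forall x, 0 <= x <= x0 -> 0 < besselG nu (4^-1 * x ^+ 2) <= 2 * besselG nu 0.
Proof.
have G0 : 0 < besselG nu 0 by rewrite besselG0 invr_gt0 Gamma_gt0// lerDr.
have cG : {for 0, continuous (fun x => besselG nu (4^-1 * x ^+ 2))}.
  have h := is_derive_besselG (4^-1 * 0 ^+ 2) nu0.
  apply: is_derive_cvg; by der.
have e1 : (\forall x \near (0 : R), 0 < besselG nu (4^-1 * x ^+ 2)).
  by apply: (@cvgr_gt _ _ (nbhs (0:R)) _ _ _ cG); rewrite expr0n mulr0.
have e2 : (\forall x \near (0 : R), besselG nu (4^-1 * x ^+ 2) < 2 * besselG nu 0).
  by apply: (@cvgr_lt _ _ (nbhs (0:R)) _ _ _ cG); rewrite expr0n mulr0 ltr_pMl// ltr1n.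
have [e /= e0 he] := filterI e1 e2.
exists (e / 2) => [|x /andP[x0 xe]]; first by rewrite divr_gt0.
have [|? ?] := he x; last by apply/andP; split => //; exact: ltW.
by rewrite /= sub0r normrN ger0_norm// (le_lt_trans xe)// ltr_pdivrMr// ltr_pMr// ltr1n.
Qed.

Lemma besselU_gt0 x : 0 < x -> 0 < besselG nu (4^-1 * x ^+ 2) -> 0 < besselU x.
Proof. by move=> x0 G0; rewrite mulr_gt0// powR_gt0. Qed.

End BesselODE.

(** * Positive zeros of Bessel functions *)

Section BesselZeros.
Variable R : realType.
Variable nu : R.
Hypothesis nu0 : 0 <= nu.
Implicit Types (a b x y z M : R) (k n : nat).

Let c0 : R := 4^-1 - nu ^+ 2.
Let UE : forall x, 0 < x -> is_derive x 1 (besselU nu) (besselU1 nu x).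
Proof. by move=> x; exact: is_derive_besselU. Qed.
Let U1E : forall x, 0 < x ->
  is_derive x 1 (besselU1 nu) (- (1 + c0 / x ^+ 2) * besselU nu x).
Proof. by move=> x; exact: is_derive_besselU1. Qed.

Local Notation E := (energy (besselU nu) (besselU1 nu)).

(** [besselU nu] is positive near the origin, and the energy of a solution cannot
    vanish later if it does not vanish earlier. *)
Lemma bessel_energy_gt0 x : 0 < x -> 0 < E x.
Proof.
move=> x0; have [e e0 Ge] := besselG_gt0_near0 nu0.
have Ee y : 0 < y -> y <= e -> 0 < E y.
  move=> y0 ye; have /andP[Gy _] : 0 < besselG nu (4^-1 * y ^+ 2) <= 2 * besselG nu 0.
    by apply: Ge; rewrite ye ltW.
  by rewrite /energy ltr_pwDl ?sqr_ge0// exprn_gt0// besselU_gt0.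
have [xe|/ltW ex] := leP x e; first exact: Ee.
apply: lt_le_trans (energy_ge UE U1E e0 ex).
by rewrite mulr_gt0 ?expR_gt0// Ee.
Qed.

Lemma besselJ_gap a b M : 0 < a -> a < b -> besselJ nu a = 0 -> besselJ nu b = 0 ->
  0 < M -> 1 + `|c0| / a ^+ 2 <= M ^+ 2 -> pi / M <= b - a.
Proof.
move=> a0 ab /eqP Ja /eqP Jb M0 aM.
have b0 : 0 < b by exact: lt_trans ab.
rewrite besselJ_eq0// in Ja; rewrite besselJ_eq0// in Jb.
rewrite ler_pdivrMr// mulrC.
apply: (zero_gap UE U1E a0 ab (eqP Ja) (eqP Jb) M0) => [x /andP[ax _]|]; last first.
  exact: bessel_energy_gt0.
apply: le_trans aM; rewrite lerD2l.
have x0 : 0 < x by exact: lt_le_trans ax.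
apply: (@le_trans _ _ (`|c0| / x ^+ 2)).
  by rewrite ler_pM2r ?invr_gt0 ?exprn_gt0// ler_norm.
rewrite ler_wpM2l// lef_pV2 ?posrE ?exprn_gt0//.
by rewrite lerXn2r// nnegrE ltW.
Qed.

Lemma besselJ_zeros_unbounded x : exists2 z, x < z & besselJ nu z = 0.
Proof.
(* beyond [a], the coefficient [1 + c0 / y^2] is at least [(1 / 2)^2] *)
pose a := `|x| + 2 * `|c0| + 1.
have a1 : 2 * `|c0| + 1 <= a by rewrite /a lerD2r lerDr.
have ca : 0 <= `|c0| by [].
have a0 : 0 < a by apply: lt_le_trans a1; rewrite ltr_wpDl// mulr_ge0.
have [||z az /eqP Uz] := zero_exists UE U1E a0 (m := 2^-1); first by rewrite invr_gt0.
  move=> y ay; have y0 : 0 < y by exact: lt_le_trans ay.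
  have : - (`|c0| / y ^+ 2) <= c0 / y ^+ 2.
    by rewrite -mulNr ler_pM2r ?invr_gt0 ?exprn_gt0// lerNl -normrN ler_norm.
  have : `|c0| / y ^+ 2 <= 2^-1.
    rewrite ler_pdivrMr ?exprn_gt0//; have := le_trans a1 ay.
    by move: (`|c0|) ca => c hc hca; nra.
  have -> : 2^-1 ^+ 2 = 4^-1 :> R by field.
  by lra.
have z0 : 0 < z by exact: lt_le_trans az.
exists z; last by apply/eqP; rewrite besselJ_eq0.
apply: lt_le_trans az; rewrite /a -addrA (le_lt_trans (ler_norm x))// ltrDl.
by rewrite ltr_wpDl// mulr_ge0.
Qed.

Lemma besselJ_zeros_separated : exists x0 d : R, [/\ 0 < x0, 0 < d,
  (forall x, 0 < x -> besselJ nu x = 0 -> x0 < x) &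
  (forall a b, 0 < a -> a < b -> besselJ nu a = 0 -> besselJ nu b = 0 -> d <= b - a)].
Proof.
have [e e0 Ge] := besselG_gt0_near0 nu0.
have big x : 0 < x -> besselJ nu x = 0 -> e < x.
  move=> x0 /eqP; rewrite besselJ_eq0//; apply: contraTT; rewrite -leNgt => xe.
  have /andP[Gx _] : 0 < besselG nu (4^-1 * x ^+ 2) <= 2 * besselG nu 0.
    by apply: Ge; rewrite xe ltW.
  by rewrite gt_eqF// besselU_gt0.
pose M := 1 + `|c0| / e ^+ 2.
have M1 : 1 <= M by rewrite lerDl divr_ge0// sqr_ge0.
have M0 : 0 < M by exact: lt_le_trans M1.
exists e, (pi / M); split => //; first by rewrite divr_gt0// pi_gt0.
move=> a b a0 ab Ja Jb; apply: besselJ_gap => //.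
apply: (@le_trans _ _ M); last by rewrite ler_eXnr.
rewrite lerD2l ler_wpM2l// lef_pV2 ?posrE ?exprn_gt0//.
by rewrite lerXn2r ?nnegrE ?ltW// big.
Qed.

(** A zero closer to the infimum than the separation of the zeros must be the
    infimum itself. *)
Lemma inf_zeros p : 0 <= p ->
  let z := inf [set x | p < x /\ besselJ nu x = 0] in p < z /\ besselJ nu z = 0.
Proof.
move=> p0 z; have [x0 [d [x00 d0 _ gap]]] := besselJ_zeros_separated.
pose S := [set x | p < x /\ besselJ nu x = 0].
have S0 : S !=set0 by have [y py Jy] := besselJ_zeros_unbounded p; exists y.
have lS : has_lbound S by exists p => y [/ltW].
have [y [py Jy] yz] := inf_adherent d0 (conj S0 lS).
suff -> : z = y by [].
apply/eqP; rewrite eq_le ge_inf//=; apply: lb_le_inf => // x [px Jx].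
rewrite leNgt; apply/negP => xy.
have zx : z <= x by apply: ge_inf.
have := gap x y (le_lt_trans p0 px) xy Jx Jy.
by rewrite leNgt ltrBlDr addrC (lt_le_trans yz)// lerD2r.
Qed.

Lemma bessel_zeroP k : 0 < bessel_zero nu k /\ besselJ nu (bessel_zero nu k) = 0.
Proof.
elim: k => [|k [z0 Jz]]; first exact: (@inf_zeros 0).
have [zz ?] := inf_zeros (ltW z0).
by split => //; apply: lt_trans zz.
Qed.

Lemma bessel_zero_lt k : bessel_zero nu k < bessel_zero nu k.+1.
Proof. by have [z0 _] := bessel_zeroP k; have [] := inf_zeros (ltW z0). Qed.

Lemma bessel_zero_uniform_gap : exists2 d : R, 0 < d & uniform_gap d (bessel_zero nu).
Proof.
have [x0 [d [x00 d0 big gap]]] := besselJ_zeros_separated.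
exists (Num.min d x0); first by rewrite lt_min d0.
split=> [k|].
  rewrite ge_min; apply/orP; left; have [z0 Jz] := bessel_zeroP k.
  have [_ Jz1] := bessel_zeroP k.+1.
  by apply: gap => //; exact: bessel_zero_lt.
rewrite ge_min; apply/orP; right; have [z0 Jz] := bessel_zeroP 0.
by have := big _ z0 Jz; lra.
Qed.

(** Far from the origin the coefficient [1 + c0 / x^2] is at most [M^2], and
    Sturm comparison applies. *)
Lemma bessel_zero_asymptotic_gap M : 1 < M ->
  exists N, uniform_gap (pi / M) (fun k => bessel_zero nu (N + k)%N).
Proof.
move=> M1; have M0 : 0 < M by exact: lt_trans M1.
have MM : 0 < M ^+ 2 - 1 by nra.
have [d d0 zd] := bessel_zero_uniform_gap.
(* for [X <= z] the terms 1 and [pi] give [|c0| / (M^2 - 1) <= z^2] and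
   [pi / M <= 2 z] *)
pose X := `|c0| / (M ^+ 2 - 1) + 1 + pi.
have X0 : 0 <= `|c0| / (M ^+ 2 - 1) by rewrite divr_ge0// ltW.
have pi0 := pi_gt0 R.
pose N := Num.bound (X / d).
have zN k : (N <= k)%N -> X <= bessel_zero nu k.
  move=> Nk; have := uniform_gap_sub zd (leq0n k); rewrite subn0.
  have [z0 _] := bessel_zeroP 0.
  have : X <= k%:R * d.
    rewrite -ler_pdivrMr// (le_trans (ltW (archi_boundP _)))//.
      by rewrite divr_ge0// /X; lra.
    by rewrite ler_nat.
  by lra.
exists N; split=> [k|]; last first.
  rewrite addn0; have := zN N (leqnn _).
  have : pi / M <= pi by rewrite ler_pdivrMr// ler_peMr// ltW.
  by rewrite /X; lra.
rewrite addnS; have [z0 Jz] := bessel_zeroP (N + k); have [_ Jz1] := bessel_zeroP (N + k).+1.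
apply: besselJ_gap => //; first exact: bessel_zero_lt.
have := zN (N + k)%N (leq_addr _ _); move: (bessel_zero nu (N + k)) z0 => z z0 Xz.
rewrite -lerBrDl ler_pdivrMr ?exprn_gt0// mulrC -ler_pdivrMr//.
rewrite /X in Xz; move: (`|c0| / (M ^+ 2 - 1)) X0 Xz => q q0 Xz; clear -q0 Xz pi0.
have z1 : 1 <= z by lra.
have qz : q <= z by lra.
by nra.
Qed.

(** At a zero [z], [z * J_nu' z ^+ 2] is a constant multiple of the energy of
    [besselU nu]. *)
Lemma bessel_zero_derive_bounds : exists c C : R, [/\ 0 < c, 0 < C & forall k,
  c <= bessel_zero nu k * derive1 (besselJ nu) (bessel_zero nu k) ^+ 2 <= C].
Proof.
have [x0 [d [x00 d0 big _]]] := besselJ_zeros_separated.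
have E0 := bessel_energy_gt0 x00.
pose K : R := (2 `^ (- nu)) ^+ 2.
have K0 : 0 < K by rewrite exprn_gt0// powR_gt0.
exists (K * (E x0 * expR (- (`|c0| / x0)))), (K * (E x0 * expR (`|c0| / x0))).
split=> [||k]; [by rewrite !mulr_gt0 ?expR_gt0..|].
have [z0 Jz] := bessel_zeroP k; have xz := ltW (big _ z0 Jz).
rewrite derive1_besselJ//; move: (bessel_zero nu k) z0 Jz xz => z z0 /eqP Jz xz.
have -> : z * (2 `^ (- nu) * (z `^ (- 2^-1) * besselU1 nu z)) ^+ 2 = K * E z.
  have -> : E z = besselU1 nu z ^+ 2.
    by move: Jz; rewrite besselJ_eq0// /energy => /eqP ->; rewrite expr0n add0r.
  have zz : z * z `^ (- 2^-1) ^+ 2 = 1.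
    rewrite -powR_mulrn ?powR_ge0// -powRrM.
    by rewrite (_ : - 2^-1 * 2%:R = -1) ?powR_inv1 ?ltW// ?mulfV ?gt_eqF//; field.
  transitivity ((z * z `^ (- 2^-1) ^+ 2) * (K * besselU1 nu z ^+ 2)).
    by rewrite /K; move: (2 `^ _) (z `^ _) => *; ring.
  by rewrite zz mul1r.
have h1 := energy_ge UE U1E x00 xz; have h2 := energy_le UE U1E x00 xz.
by apply/andP; split; rewrite (ler_pM2l K0); [exact: h1|exact: h2].
Qed.

(** Away from the origin, the energy bounds [z^(nu + 1 / 2) * besselG nu], hence
    [besselG nu]. *)
Lemma besselG_sqr_bounded : exists2 C : R, 0 < C &
  forall z, 0 <= z -> `|besselG nu (4^-1 * z ^+ 2)| <= C.
Proof.
have [e e0 Ge] := besselG_gt0_near0 nu0.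
have G0 : 0 < besselG nu 0 by rewrite besselG0 invr_gt0 Gamma_gt0// lerDr.
pose p := nu + 2^-1; pose K := E e * expR (`|c0| / e).
have K0 : 0 < K by rewrite mulr_gt0 ?expR_gt0// bessel_energy_gt0.
have ep : 0 < e `^ p by rewrite powR_gt0.
have p0 : 0 <= p by rewrite addr_ge0// invr_ge0.
have D0 : 0 < (K + 1) / e `^ p by rewrite divr_gt0// addr_gt0.
exists (2 * besselG nu 0 + (K + 1) / e `^ p) => [|z z0]; first by rewrite addr_gt0// mulr_gt0.
have [ze|ez] := leP z e.
  have /andP[h1 h2] := Ge z (introT andP (conj z0 ze)).
  by rewrite gtr0_norm//; lra.
apply: (@le_trans _ _ ((K + 1) / e `^ p)); last by rewrite lerDr mulr_ge0// ltW.
rewrite ler_pdivlMr//.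
have zp : e `^ p <= z `^ p by rewrite ge0_ler_powR// ?nnegrE// ltW.
apply: (@le_trans _ _ (`|besselG nu (4^-1 * z ^+ 2)| * z `^ p)).
  by rewrite ler_wpM2l.
have UK : besselU nu z ^+ 2 <= K.
  by apply: le_trans (energy_le UE U1E e0 (ltW ez)); rewrite lerDl sqr_ge0.
have -> : `|besselG nu (4^-1 * z ^+ 2)| * z `^ p = `|besselU nu z|.
  by rewrite /besselU normrM mulrC (ger0_norm (powR_ge0 _ _)).
have := normr_ge0 (besselU nu z); move: UK; rewrite -real_normK ?num_real//.
by move: (`|besselU nu z|) => q; nra.
Qed.

End BesselZeros.

(** * Dominated convergence of series *)

Section Tannery.
Variable R : realType.

Lemma is_cvg_series_dominated (u m : nat -> R) : (forall k, `|u k| <= m k) ->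
  cvgn (series m) -> cvgn (series u).
Proof.
move=> um cm; apply: normed_cvg; apply: (series_le_cvg _ _ _ cm) => [n|n|n] //=.
by rewrite (le_trans _ (um n)).
Qed.

Lemma series_tail_le (u m : nat -> R) n : (forall k, `|u k| <= m k) ->
  cvgn (series m) -> `|limn (series u) - series u n| <= limn (series m) - series m n.
Proof.
move=> um cm; have cu := is_cvg_series_dominated um cm.
have m0 k : 0 <= m k by rewrite (le_trans _ (um k)).
have h : `|series u N - series u n| @[N --> \oo] --> `|limn (series u) - series u n|.
  by apply: cvg_norm; apply: cvgB => //; exact: cvg_cst.
rewrite -(cvg_lim _ h)//; apply: limr_le; first exact: cvgP h.
near=> N; have nN : (n <= N)%N by near: N; exact: nbhs_infty_ge.
rewrite sub_series_geq//; apply: (le_trans (ler_norm_sum _ _ _)).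
apply: (@le_trans _ _ (\sum_(n <= k < N) m k)); first exact: ler_sum.
rewrite -sub_series_geq// lerD2r; apply: nondecreasing_cvgn_le => //.
by apply: nondecreasing_series => k _ _.
Unshelve. all: by end_near. Qed.

(** Finitely many terms converge, and the remainders of the dominating series
    control all the others uniformly. *)
Lemma tannery (T : Type) (F : set_system T) (FF : Filter F)
    (e : nat -> T -> R) (l m : nat -> R) :
  (forall k x, `|e k x| <= m k) -> (forall k, `|l k| <= m k) -> cvgn (series m) ->
  (forall k, e k x @[x --> F] --> l k) ->
  limn (series (fun k => e k x)) @[x --> F] --> limn (series l).
Proof.
move=> em lm cm el; apply/cvgrPdist_lt => eps eps0.
have eps3 : 0 < eps / 3 by rewrite divr_gt0.
have [n] : exists n, limn (series m) - series m n < eps / 3.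
  have /cvgrPdist_lt/(_ _ eps3)[N _ HN] := cm.
  by exists N; have /= := HN N (leqnn _); apply: le_lt_trans; exact: ler_norm.
move=> mn.
have /cvgrPdist_lt/(_ _ eps3) : series (fun k => e k x) n @[x --> F] --> series l n.
  rewrite /series/=; elim: n {mn} => [|n IH].
    rewrite big_geq//; under eq_fun do rewrite big_geq//.
    exact: cvg_cst.
  rewrite big_nat_recr//=; under eq_fun do rewrite big_nat_recr//=.
  by apply: cvgD.
apply: filterS => x hx.
have h1 := @series_tail_le (fun k => e k x) m n (fun k => em k x) cm.
have h2 := @series_tail_le l m n lm cm.
move: hx h1 h2 mn; move: (limn (series (fun k => e k x))) (limn (series l)) (limn (series m)).
move: (series _ _) (series _ _) (series _ _) => a b c A B C.
rewrite !ltr_norml !ler_norml => /andP[? ?] /andP[? ?] /andP[? ?] ?.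
by apply/andP; split; lra.
Qed.

End Tannery.

(** * Complex limits by real and imaginary parts *)

Section ComplexLimits.
Variable R : realType.
Local Notation normc := (@ComplexField.Normc.normc R).
Implicit Types (a b l : R[i]).

Lemma normc_sqr a : normc a ^+ 2 = complex.Re a ^+ 2 + complex.Im a ^+ 2.
Proof. by case: a => x y /=; rewrite sqr_sqrtr// addr_ge0// sqr_ge0. Qed.

Lemma normc_ge0 a : 0 <= normc a.
Proof. by case: a => x y; exact: sqrtr_ge0. Qed.

Lemma Re_le_normc a : `|complex.Re a| <= normc a.
Proof.
rewrite -(@ler_sqr _ `|_|) ?nnegrE ?normc_ge0// normc_sqr real_normK ?num_real//.
by rewrite lerDl sqr_ge0.
Qed.

Lemma Im_le_normc a : `|complex.Im a| <= normc a.
Proof.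
rewrite -(@ler_sqr _ `|_|) ?nnegrE ?normc_ge0// normc_sqr real_normK ?num_real//.
by rewrite lerDr sqr_ge0.
Qed.

Lemma normc_le_ReIm a : normc a <= `|complex.Re a| + `|complex.Im a|.
Proof.
rewrite -(@ler_sqr _ (normc a)) ?nnegrE ?normc_ge0 ?addr_ge0// normc_sqr.
rewrite -(real_normK (num_real (complex.Re a))) -(real_normK (num_real (complex.Im a))).
have := normr_ge0 (complex.Re a); have := normr_ge0 (complex.Im a).
by move: (`|_|) (`|_|) => x y; nra.
Qed.

Lemma cvg_complex (T : Type) (F : set_system T) (FF : Filter F) (f : T -> R[i]) l :
  complex.Re (f x) @[x --> F] --> complex.Re l ->
  complex.Im (f x) @[x --> F] --> complex.Im l ->
  (f : T -> R[i]^o) @ F --> (l : R[i]^o).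
Proof.
move=> /cvgrPdist_lt fr /cvgrPdist_lt fi; apply/cvgrPdist_lt => e e0.
have e0' : 0 < complex.Re e by move: e0; rewrite ltcE => /andP[].
have e2 : 0 < complex.Re e / 2 by rewrite divr_gt0.
apply: filterS (filterI (fr _ e2) (fi _ e2)) => x [hr hi].
have -> : e = (complex.Re e)%:C%C.
  by move: e0; case: (e) => a b; rewrite ltcE/= => /andP[/eqP -> _].
rewrite (_ : `|_| = (normc (l - f x))%:C%C)// ltcR.
apply: (le_lt_trans (normc_le_ReIm _)); rewrite !raddfB/=.
by rewrite [ltRHS](splitr); exact: ltrD.
Qed.

Lemma cvg_ReIm (T : Type) (F : set_system T) (FF : Filter F) (f : T -> R[i]) l :
  (f : T -> R[i]^o) @ F --> (l : R[i]^o) ->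
  complex.Re (f x) @[x --> F] --> complex.Re l /\
  complex.Im (f x) @[x --> F] --> complex.Im l.
Proof.
move=> /cvgrPdist_lt fl; split; apply/cvgrPdist_lt => e e0.
  have e0' : 0 < e%:C%C :> R[i] by rewrite ltcR.
  apply: filterS (fl _ e0') => x; rewrite (_ : `|_| = (normc (l - f x))%:C%C)// ltcR.
  by apply: le_lt_trans; rewrite -raddfB; exact: Re_le_normc.
have e0' : 0 < e%:C%C :> R[i] by rewrite ltcR.
apply: filterS (fl _ e0') => x; rewrite (_ : `|_| = (normc (l - f x))%:C%C)// ltcR.
by apply: le_lt_trans; rewrite -raddfB; exact: Im_le_normc.
Qed.

End ComplexLimits.

(** * Weighted L2 sums on the unit interval *)

Section PowerIntegral.
Variable R : realType.
Local Notation mu := (@lebesgue_measure R).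

Lemma powR_integral01_lt_pinfty (r : R) : -1 < r ->
  (\int[mu]_(x in `]0%R, 1%R[) (x `^ r)%:E < +oo)%E.
Proof.
move=> r1; have r0 : 0 < r + 1 by rewrite -ltrBlDr sub0r.
pose F n := `[(n.+1%:R^-1 : R), 1]%classic.
have F0 n : 0 < (n.+1%:R^-1 : R) by rewrite invr_gt0 ltr0n.
have ndF : nondecreasing_seq F.
  move=> n m nm; apply/subsetPset; apply: subset_itvr; rewrite bnd_simp.
  by rewrite lef_pV2 ?posrE ?ltr0n// ler_nat ltnS.
have dE (x : R) : 0 < x -> is_derive x 1 (fun x => (r + 1)^-1 * x `^ (r + 1)) (x `^ r).
  by move=> x0; der; rewrite addrK; field; rewrite gt_eqF.
have cr (x : R) : 0 < x -> {for x, continuous (fun x => x `^ r)}.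
  by move=> x0; apply: (@is_derive_cvg _ _ _ (r * x `^ (r - 1))); der; ring.
have mF n : measurable_fun (F n) (fun x => (x `^ r)%:E).
  rewrite /F; apply/measurable_EFinP; apply: subspace_continuous_measurable_fun.
    exact: measurable_itv.
  apply: continuous_in_subspaceT => x; rewrite inE/= in_itv/= => /andP[nx _].
  by apply: cr; exact: lt_le_trans nx.
have FI n : (\int[mu]_(x in F n) (x `^ r)%:E <= ((r + 1)^-1)%:E)%E.
  case: n => [|n].
    by rewrite /F invr1 set_itv1 integral_set1 lee_fin invr_ge0 ltW.
  have n1 : n.+2%:R^-1 < 1 :> R by rewrite invf_lt1 ?ltr0n// ltr1n.
  rewrite /F.
  rewrite (@continuous_FTC2 _ _ (fun x => (r + 1)^-1 * x `^ (r + 1)))//.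
  - by rewrite powR1 mulr1 -EFinB lee_fin gerBl mulr_ge0 ?powR_ge0// invr_ge0 ltW.
  - apply: continuous_in_subspaceT => x; rewrite inE/= in_itv/= => /andP[nx _].
    by apply: cr; exact: lt_le_trans nx.
  - split.
    + by move=> x; rewrite in_itv/= => /andP[nx _]; case: (dE _ (lt_trans (F0 _) nx)).
    + by apply: cvg_at_right_filter; exact: is_derive_cvg (dE _ (F0 _)).
    + by apply: cvg_at_left_filter; exact: is_derive_cvg (dE _ ltr01).
  - move=> x; rewrite in_itv/= => /andP[nx _].
    exact: is_derive_val (dE _ (lt_trans (F0 _) nx)).
have UF : \bigcup_n F n = `]0, 1]%classic.
  apply/seteqP; split => x.
    move=> [n _]; rewrite /F /= !in_itv/= => /andP[nx x1]; rewrite x1 andbT.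
    exact: lt_le_trans nx.
  rewrite /= in_itv/= => /andP[x0 x1]; exists (Num.bound x^-1) => //.
  rewrite /F/= in_itv/= x1 andbT -[leRHS]invrK lef_pV2 ?posrE ?ltr0n ?invr_gt0//.
  have xi : 0 <= x^-1 by rewrite invr_ge0 ltW.
  by rewrite (le_trans (ltW (archi_boundP xi)))// ler_nat.
have ge0 n x : F n x -> (0 <= (x `^ r)%:E)%E by rewrite lee_fin powR_ge0.
have mFn n : measurable (F n) by exact: measurable_itv.
have cvF := @ge0_nondecreasing_set_cvg_integral _ _ _ _ _ mu ndF mFn mF ge0.
have mF01 : measurable_fun (`]0, 1[ : set R) (fun x => (x `^ r)%:E).
  apply/measurable_EFinP; apply: open_continuous_measurable_fun.
    exact: interval_open.
  by move=> x; rewrite inE/= in_itv/= => /andP[x0 _]; exact: cr.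
rewrite (integral_itv_bndo_bndc mF01) -UF -(cvg_lim _ cvF)//.
apply: (@le_lt_trans _ _ ((r + 1)^-1)%:E); last exact: ltry.
apply: lime_le; first exact: cvgP cvF.
by apply: nearW => n; exact: FI.
Qed.

End PowerIntegral.

Section L2Uniqueness.
Variable R : realType.
Local Notation normc := (@ComplexField.Normc.normc R).
Local Notation mu := (@lebesgue_measure R).
Implicit Types (f g h : R -> R[i]) (x beta : R).

Definition continuous01 f := forall x, 0 < x < 1 ->
  {for x, continuous (fun y => complex.Re (f y))} /\
  {for x, continuous (fun y => complex.Im (f y))}.

Lemma within_continuous01 f :
  {within `]0%R, 1%R[, continuous (f : R -> R[i]^o)} <-> continuous01 f.
Proof.
split=> [cf x x01|cf].
  rewrite continuous_open_subspace in cf; last exact: interval_open.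
  by apply: cvg_ReIm; apply: cf; rewrite inE/= in_itv.
rewrite continuous_open_subspace; last exact: interval_open.
move=> x; rewrite inE/= in_itv/= => /cf[h1 h2].
exact: (@cvg_complex _ _ (nbhs x) _ f (f x)).
Qed.

Definition dist2 beta f g x : R := normc (f x - g x) ^+ 2 * x `^ beta.

Lemma dist2_ge0 beta f g x : 0 <= dist2 beta f g x.
Proof. by rewrite mulr_ge0 ?sqr_ge0// powR_ge0. Qed.

Lemma dist2_continuous beta f g x : continuous01 f -> continuous01 g ->
  0 < x < 1 -> {for x, continuous (dist2 beta f g)}.
Proof.
move=> cf cg x01; have /andP[x0 _] := x01.
have [f1 f2] := cf x x01; have [g1 g2] := cg x x01.
have -> : dist2 beta f g = fun y =>
    ((complex.Re (f y) - complex.Re (g y)) * (complex.Re (f y) - complex.Re (g y)) +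
     (complex.Im (f y) - complex.Im (g y)) * (complex.Im (f y) - complex.Im (g y)))
    * y `^ beta.
  by apply/funext => y; rewrite /dist2 normc_sqr !raddfB/= !expr2.
have hp : {for x, continuous (fun y : R => y `^ beta)}.
  by apply: (@is_derive_cvg _ _ _ (beta * x `^ (beta - 1))); der; ring.
by apply: cvgM => //; apply: cvgD; apply: cvgM; apply: cvgB.
Qed.

Lemma dist2_measurable beta f g : continuous01 f -> continuous01 g ->
  measurable_fun (`]0, 1[ : set R) (EFin \o dist2 beta f g).
Proof.
move=> cf cg; apply/measurable_EFinP; apply: open_continuous_measurable_fun.
  exact: interval_open.
by move=> x; rewrite inE/= in_itv/= => x01; exact: dist2_continuous.
Qed.

(** By the triangle inequality [f] and [g] are at distance zero, while
    [f x != g x] would keep the integrand of their distance above a positive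
    constant on a whole interval. *)
Lemma L2_limit_unique beta f g (h : nat -> R -> R[i]) :
  continuous01 f -> continuous01 g -> (forall n, continuous01 (h n)) ->
  (fun n => \int[mu]_(x in `]0%R, 1%R[) (dist2 beta f (h n) x)%:E)%E @ \oo --> 0%E ->
  (fun n => \int[mu]_(x in `]0%R, 1%R[) (dist2 beta g (h n) x)%:E)%E @ \oo --> 0%E ->
  forall x, 0 < x < 1 -> f x = g x.
Proof.
move=> cf cg ch fh gh x x01.
pose I := (\int[mu]_(x in `]0%R, 1%R[) (dist2 beta f g x)%:E)%E.
have mfg := dist2_measurable beta cf cg.
have I0 : (I <= 0)%E.
  have le n : (I <= 2%:E * (\int[mu]_(x in `]0%R, 1%R[) (dist2 beta f (h n) x)%:E) +
      2%:E * (\int[mu]_(x in `]0%R, 1%R[) (dist2 beta g (h n) x)%:E))%E.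
    have mf := dist2_measurable beta cf (ch n).
    have mg := dist2_measurable beta cg (ch n).
    rewrite -!ge0_integralZl//; try by move=> y _; rewrite lee_fin dist2_ge0.
    rewrite -ge0_integralD//; first last.
    - exact: measurable_funeM.
    - by move=> y _; rewrite mule_ge0// lee_fin dist2_ge0.
    - exact: measurable_funeM.
    - by move=> y _; rewrite mule_ge0// lee_fin dist2_ge0.
    apply: ge0_le_integral => //.
    - by move=> y _; rewrite lee_fin dist2_ge0.
    - by apply: emeasurable_funD; exact: measurable_funeM.
    move=> y _; rewrite -!EFinM -EFinD lee_fin /dist2.
    have : normc (f y - g y) ^+ 2 <=
        2 * normc (f y - h n y) ^+ 2 + 2 * normc (g y - h n y) ^+ 2.
      rewrite !normc_sqr !raddfB/=.
      move: (complex.Re (f y)) (complex.Re (g y)) (complex.Re (h n y)) => a b c.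
      move: (complex.Im (f y)) (complex.Im (g y)) (complex.Im (h n y)) => a' b' c'.
      have := sqr_ge0 ((a - c) + (b - c)); have := sqr_ge0 ((a' - c') + (b' - c')).
      by nra.
    move: (normc _ ^+ 2) (normc _ ^+ 2) (normc _ ^+ 2) => u v w uvw.
    by rewrite !mulrA -mulrDl ler_wpM2r// powR_ge0.
  have : (fun n => 2%:E * (\int[mu]_(x in `]0%R, 1%R[) (dist2 beta f (h n) x)%:E) +
      2%:E * (\int[mu]_(x in `]0%R, 1%R[) (dist2 beta g (h n) x)%:E))%E @ \oo -->
      (2%:E * 0 + 2%:E * 0)%E.
    by apply: cvgeD => //; apply: cvgeZl.
  rewrite !mule0 adde0 => lim0.
  rewrite -(cvg_lim _ lim0)//; apply: lime_ge; first exact: cvgP lim0.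
  by apply: nearW => n; exact: le.
have /andP[x0 x1] := x01.
have [//|fgx] := eqVneq (f x) (g x).
have d0 : 0 < dist2 beta f g x.
  rewrite mulr_gt0 ?powR_gt0// exprn_gt0// lt_neqAle normc_ge0 andbT eq_sym.
  by apply: contra fgx => /eqP /ComplexField.Normc.eq0_normc /eqP; rewrite subr_eq0.
set d := dist2 beta f g x in d0.
have near_d : \forall y \near x, d / 2 < dist2 beta f g y.
  apply: (@cvgr_gt _ _ (nbhs x) _ _ _ (dist2_continuous (beta := beta) cf cg x01)).
  by rewrite ltr_pdivrMr// ltr_pMr// ltr1n.
have [e /= e0 He] := near_d.
pose r := Num.min (e / 2) (Num.min (x / 2) ((1 - x) / 2)).
have r0 : 0 < r by rewrite !lt_min !divr_gt0// subr_gt0.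
have re : r < e by rewrite gt_min; apply/orP; left; rewrite ltr_pdivrMr// ltr_pMr// ltr1n.
have rx : r <= x / 2 by rewrite !ge_min lexx orbT.
have r1 : r <= (1 - x) / 2 by rewrite !ge_min lexx !orbT.
have sub : `[x, x + r] `<=` (`]0, 1[ : set R).
  move=> y /=; rewrite !in_itv/= => /andP[y1 y2]; apply/andP; split; lra.
have h1 : (\int[mu]_(y in `[x, (x + r)%R]) (dist2 beta f g y)%:E <= I)%E.
  by apply: ge0_subset_integral => // y _; rewrite lee_fin dist2_ge0.
have h2 : (\int[mu]_(y in `[x, (x + r)%R]) (d / 2)%:E <=
    \int[mu]_(y in `[x, (x + r)%R]) (dist2 beta f g y)%:E)%E.
  apply: ge0_le_integral => //.
  - by move=> y _; rewrite lee_fin divr_ge0// ltW.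
  - exact: measurable_funS mfg.
  - move=> y /=; rewrite in_itv/= => /andP[y1 y2]; rewrite lee_fin ltW//.
    by apply: He; rewrite /= ltr_norml; apply/andP; split; lra.
have h3 : (\int[mu]_(y in `[x, (x + r)%R]) (d / 2)%:E = (r * (d / 2))%:E)%E.
  rewrite integral_cst//= lebesgue_measure_itv/= lte_fin ltrDl r0 -EFinB -EFinM.
  by congr (_%:E); ring.
have := le_trans h2 h1; rewrite h3.
move=> /le_trans/(_ I0); rewrite lee_fin leNgt mulr_gt0//.
by rewrite divr_gt0.
Qed.

End L2Uniqueness.

(** * The weighted trace at the origin *)

Section Observation.
Variables (R : realType) (alpha beta mu : R).
Hypothesis alpha2 : alpha < 2.
Local Notation normc := (@ComplexField.Normc.normc R).
Local Notation leb := (@lebesgue_measure R).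
Local Notation kap := (kappa alpha).
Local Notation nn := (nu alpha beta mu).
Local Notation z := (bessel_zero nn).
Local Notation gam := (gamma alpha beta mu).
Implicit Types (x : R) (k n : nat) (d m : nat -> R) (a : coefs R).

Lemma kappa_gt0 : 0 < kap.
Proof. by rewrite divr_gt0// subr_gt0. Qed.

Lemma nu_ge0 : 0 <= nn.
Proof. by rewrite divr_ge0 ?sqrtr_ge0// mulr_ge0// ltW// kappa_gt0. Qed.

Let z0 k : 0 < z k. Proof. by have [] := bessel_zeroP nu_ge0 k. Qed.

Lemma gammaE k : gam k = kap * z k.
Proof.
rewrite /gamma /lambda -exprMn sqrtr_sqr gtr0_norm//.
by rewrite mulr_gt0// kappa_gt0.
Qed.

Lemma gamma_gt0 k : 0 < gam k.
Proof. by rewrite gammaE mulr_gt0// kappa_gt0. Qed.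

Lemma lambda_powR k (s : R) : lambda alpha beta mu k `^ s = gam k `^ (2 * s).
Proof.
rewrite /lambda -exprMn -gammaE powRrM powR_mulrn//.
exact/ltW/gamma_gt0.
Qed.

(** By [PhiE] and [profile_cvg0], the weighted trace of [Phi k] at the origin is
    [mode_weight k] times the constant [besselG nu 0]. *)
Definition mode_weight k : R :=
  Num.sqrt (2 * kap) / `|derive1 (besselJ nn) (z k)| * (2 `^ (- nn) * z k `^ nn).

(** The leading exponent of every [Phi k] at the origin; both cases of
    [observation] divide by this same power of [x]. *)
Definition edge_exponent : R := sigma alpha beta + kap * nn.

(** What is left of [Phi k] besides its coefficient and its leading power. It is
    bounded uniformly in [k] and continuous up to the origin, so that traces can
    be taken term by term. *)
Definition profile k x : R := besselG nn (4^-1 * (z k * x `^ kap) ^+ 2).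

Lemma PhiE k x : 0 < x ->
  Phi alpha beta mu k x = mode_weight k * x `^ edge_exponent * profile k x.
Proof.
move=> x0; have y0 : 0 < z k * x `^ kap by rewrite mulr_gt0// powR_gt0.
rewrite /Phi besselJE ?nu_ge0// /mode_weight /profile /edge_exponent.
rewrite (powRM _ (ltW (z0 k)) (powR_ge0 _ _)) -powRrM powRD ?(gt_eqF x0) ?implybT//.
move: (besselG _ _) (`|_|^-1) (2 `^ _) (x `^ _) (x `^ _) (z k `^ _) (Num.sqrt _) => *.
by ring.
Qed.

Lemma mode_weight_ge0 k : 0 <= mode_weight k.
Proof.
by rewrite mulr_ge0 ?mulr_ge0 ?powR_ge0 ?sqrtr_ge0 ?invr_ge0.
Qed.

(** [mode_weight k ^+ 2] is a constant multiple of
    [j_k^(2 nu) / J_nu' (j_k)^2], and [j_k * J_nu' (j_k)^2] stays between two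
    positive constants. *)
Lemma mode_weight_bounds : exists c C : R, [/\ 0 < c, 0 < C & forall k,
  c * gam k `^ (2 * nn + 1) <= mode_weight k ^+ 2 <= C * gam k `^ (2 * nn + 1)].
Proof.
have [c1 [C1 [c10 C10 cC]]] := bessel_zero_derive_bounds nu_ge0.
have kap0 := kappa_gt0.
pose K : R := 2 * kap * (2 `^ (- nn)) ^+ 2 / kap `^ (2 * nn + 1).
have K0 : 0 < K.
  have r0 : 0 < 2 `^ (- nn) :> R by rewrite powR_gt0.
  exact: divr_gt0 (mulr_gt0 (mulr_gt0 (ltr0Sn _ 1) kap0) (exprn_gt0 2 r0)) (powR_gt0 _ kap0).
exists (K / C1), (K / c1); split => [||k]; [exact: divr_gt0 K0 C10|exact: divr_gt0 K0 c10|].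
have /andP[h1 h2] := cC k; set D := derive1 _ _ in h1 h2.
have zD : 0 < z k * D ^+ 2 by exact: lt_le_trans h1.
have D0 : D != 0 by apply: contraTneq zD => ->; rewrite expr0n mulr0 ltxx.
have g0 : 0 < gam k `^ (2 * nn + 1) by rewrite powR_gt0// gamma_gt0.
have -> : mode_weight k ^+ 2 = K / (z k * D ^+ 2) * gam k `^ (2 * nn + 1).
  rewrite /mode_weight -/D !exprMn exprVn real_normK ?num_real//.
  rewrite sqr_sqrtr; last by rewrite mulr_ge0// ltW.
  rewrite /K gammaE (powRM _ (ltW kap0) (ltW (z0 k))).
  have -> : z k `^ (2 * nn + 1) = (z k `^ nn) ^+ 2 * z k.
    rewrite powRD ?(gt_eqF (z0 k)) ?implybT// powRr1 ?(ltW (z0 k))//.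
    by rewrite [2 * nn]mulrC powRrM (powR_mulrn _ (powR_ge0 _ _)).
  have kp : kap `^ (2 * nn + 1) != 0 by rewrite gt_eqF ?powR_gt0.
  have zk : z k != 0 by rewrite gt_eqF.
  move: (kap `^ _) kp (2 `^ _) (z k `^ _) => q q0 r s.
  by field; rewrite q0 zk D0.
by apply/andP; split; rewrite (ler_pM2r g0) (ler_pM2l K0) lef_pV2 ?posrE.
Qed.

Lemma profile_bounded : exists2 B : R, 0 < B & forall k x, `|profile k x| <= B.
Proof.
have [B B0 GB] := besselG_sqr_bounded nu_ge0; exists B => // k x.
by apply: GB; rewrite mulr_ge0 ?powR_ge0// ltW.
Qed.

Lemma profile_continuous k x : 0 < x -> {for x, continuous (profile k)}.
Proof.
move=> x0; have h := is_derive_besselG (4^-1 * (z k * x `^ kap) ^+ 2) nu_ge0.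
rewrite /profile; move: (besselG nn) (besselG (nn + 1)) h => A A1.
move: (z k) kap => w q h.
by eapply is_derive_cvg; der; reflexivity.
Qed.

Lemma profile_cvg0 k : profile k x @[x --> 0^'+] --> besselG nn 0.
Proof.
have h := is_derive_besselG 0 nu_ge0.
have c0 : 4^-1 * (z k * x `^ kap) ^+ 2 @[x --> 0^'+] --> (0 : R).
  rewrite [X in _ --> X](_ : 0 = 4^-1 * (z k * 0 * (z k * 0))); last by ring.
  apply: cvgM; first exact: cvg_cst.
  by apply: cvgM; (apply: cvgM; [exact: cvg_cst|exact/powR_cvg0/kappa_gt0]).
apply: (@cvg_comp _ _ _ _ (besselG nn) (0^'+) (nbhs (0 : R)) _ c0).
exact: is_derive_cvg h.
Qed.

Definition profile_series d x : R := limn (series (fun k => d k * profile k x)).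

Lemma profile_series_cvg (F : set_system R) (FF : Filter F) d m (l : nat -> R) B :
  (forall k, `|d k| <= m k) -> cvgn (series m) ->
  (forall k x, `|profile k x| <= B) -> (forall k, `|l k| <= B) ->
  (forall k, profile k x @[x --> F] --> l k) ->
  profile_series d x @[x --> F] --> limn (series (fun k => d k * l k)).
Proof.
move=> dm cm pB lB pl; apply: (@tannery _ _ F FF _ _ (fun k => m k * B)).
- by move=> k x; rewrite normrM; apply: ler_pM.
- by move=> k; rewrite normrM; apply: ler_pM.
- rewrite (_ : series _ = fun n => series m n * B).
    by apply: is_cvgM => //; exact: is_cvg_cst.
  by apply/funext => n; rewrite /series/= mulr_suml.
- by move=> k; apply: cvgM; [exact: cvg_cst|exact: pl].
Qed.

Lemma profile_series_tail d m B n x :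
  (forall k, `|d k| <= m k) -> cvgn (series m) -> (forall k x, `|profile k x| <= B) ->
  `|profile_series d x - \sum_(0 <= k < n) d k * profile k x| <=
  (limn (series m) - series m n) * B.
Proof.
move=> dm cm pB.
have E : series (fun k => m k * B) = fun n => series m n * B.
  by apply/funext => i; rewrite /series/= mulr_suml.
have cB : cvgn (series (fun k => m k * B)).
  by rewrite E; apply: is_cvgM => //; exact: is_cvg_cst.
have := @series_tail_le _ (fun k => d k * profile k x) (fun k => m k * B) n _ cB.
have -> : limn (series (fun k => m k * B)) = limn (series m) * B.
  by rewrite E; apply: cvg_lim => //; apply: cvgM => //; exact: cvg_cst.
rewrite E -mulrBl; apply => k; rewrite normrM; exact: ler_pM.
Qed.

Definition representative a x : R[i] :=
  ((x `^ edge_exponent * profile_series (fun k => mode_weight k * complex.Re (a k)) x)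
   +i* (x `^ edge_exponent * profile_series (fun k => mode_weight k * complex.Im (a k)) x))%C.

Definition edge_summable a := cvgn (series (fun k => mode_weight k * normc (a k))).

Let wRe a k : `|mode_weight k * complex.Re (a k)| <= mode_weight k * normc (a k).
Proof.
rewrite normrM (ger0_norm (mode_weight_ge0 k)) ler_wpM2l ?mode_weight_ge0//.
exact: Re_le_normc.
Qed.

Let wIm a k : `|mode_weight k * complex.Im (a k)| <= mode_weight k * normc (a k).
Proof.
rewrite normrM (ger0_norm (mode_weight_ge0 k)) ler_wpM2l ?mode_weight_ge0//.
exact: Im_le_normc.
Qed.

Lemma profile_series_continuous d m x : (forall k, `|d k| <= m k) ->
  cvgn (series m) -> 0 < x -> {for x, continuous (profile_series d)}.
Proof.
move=> dm cm x0; have [B B0 pB] := profile_bounded.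
apply: (@profile_series_cvg (nbhs x) _ d m (fun k => profile k x) B) => // k.
exact: profile_continuous.
Qed.

Lemma representative_continuous a : edge_summable a -> continuous01 (representative a).
Proof.
move=> sa x /andP[x0 _].
have hp : {for x, continuous (fun y : R => y `^ edge_exponent)}.
  by apply: (@is_derive_cvg _ _ _ (edge_exponent * x `^ (edge_exponent - 1))); der; ring.
by split; apply: cvgM => //; apply: profile_series_continuous sa x0.
Qed.

Definition partial_sum a n x : R[i] :=
  \sum_(0 <= k < n) a k * (Phi alpha beta mu k x)%:C%C.

Lemma Re_mul_real (u : R[i]) (r : R) : complex.Re (u * r%:C%C) = complex.Re u * r.
Proof. by case: u => s t /=; rewrite mulr0 subr0. Qed.

Lemma Im_mul_real (u : R[i]) (r : R) : complex.Im (u * r%:C%C) = complex.Im u * r.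
Proof. by case: u => s t /=; rewrite mulr0 add0r. Qed.

Lemma Re_partial_sum a n x : 0 < x -> complex.Re (partial_sum a n x) =
  x `^ edge_exponent *
  \sum_(0 <= k < n) mode_weight k * complex.Re (a k) * profile k x.
Proof.
move=> x0; rewrite raddf_sum/= mulr_sumr; apply: eq_bigr => k _.
by rewrite Re_mul_real PhiE//; ring.
Qed.

Lemma Im_partial_sum a n x : 0 < x -> complex.Im (partial_sum a n x) =
  x `^ edge_exponent *
  \sum_(0 <= k < n) mode_weight k * complex.Im (a k) * profile k x.
Proof.
move=> x0; rewrite raddf_sum/= mulr_sumr; apply: eq_bigr => k _.
by rewrite Im_mul_real PhiE//; ring.
Qed.

Lemma near_eq_continuous_at (f g : R -> R) x : (\forall y \near x, f y = g y) ->
  {for x, continuous g} -> {for x, continuous f}.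
Proof.
move=> fg cg; rewrite /prop_for /continuous_at (nbhs_singleton fg).
by apply: cvg_trans cg; apply: near_eq_cvg; apply: filterS fg => y ->.
Qed.

Lemma partial_sum_continuous a n : continuous01 (partial_sum a n).
Proof.
move=> x /andP[x0 _].
have hp : {for x, continuous (fun y : R => y `^ edge_exponent)}.
  by apply: (@is_derive_cvg _ _ _ (edge_exponent * x `^ (edge_exponent - 1))); der; ring.
have near0 : \forall y \near x, 0 < y by exact: lt_nbhsr.
have sum_cont (d : nat -> R) :
    {for x, continuous (fun y => \sum_(0 <= k < n) d k * profile k y)}.
  elim: n => [|n IH].
    rewrite (_ : (fun y => _) = fun=> 0); first exact: cvg_cst.
    by apply/funext => y; rewrite big_geq.
  rewrite (_ : (fun y => _) = fun y =>
    \sum_(0 <= k < n) d k * profile k y + d n * profile n y); last first.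
    by apply/funext => y; rewrite big_nat_recr.
  apply: cvgD; first exact: IH.
  by apply: cvgM; [exact: cvg_cst|exact: profile_continuous].
split.
- apply: (near_eq_continuous_at _ (cvgM hp (sum_cont _))).
  by apply: filterS near0 => y y0; rewrite Re_partial_sum.
- apply: (near_eq_continuous_at _ (cvgM hp (sum_cont _))).
  by apply: filterS near0 => y y0; rewrite Im_partial_sum.
Qed.

Lemma edge_integral_lt_pinfty :
  (\int[leb]_(x in `]0%R, 1%R[) (x `^ (2 * edge_exponent + beta))%:E < +oo)%E.
Proof.
apply: powR_integral01_lt_pinfty.
have : 0 <= kap * nn by rewrite mulr_ge0 ?nu_ge0// ltW// kappa_gt0.
rewrite /edge_exponent /sigma; move: (kap * nn) => q q0.
have -> : 2 * ((1 - alpha - beta) / 2 + q) + beta = -1 + (2 - alpha + 2 * q) by field.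
by rewrite ltrDl ltr_pwDl ?subr_gt0// mulr_ge0.
Qed.

(** The remainders of the series of profiles are uniformly small, and the factor
    [x^(2 edge_exponent + beta)] is integrable, its exponent being
    [1 - alpha + 2 kappa nu > -1]. *)
Lemma representative_L2_sum a : edge_summable a ->
  is_L2_sum alpha beta mu a (representative a).
Proof.
move=> sa; have [B B0 pB] := profile_bounded.
pose m k := mode_weight k * normc (a k).
pose tau n := (limn (series m) - series m n) * B.
have tau0 : tau @ \oo --> 0.
  rewrite [X in _ --> X](_ : 0 = (limn (series m) - limn (series m)) * B); last first.
    by rewrite subrr mul0r.
  by apply: cvgM; [apply: cvgB => //; exact: cvg_cst|exact: cvg_cst].
have I_fin := edge_integral_lt_pinfty.
set I := (\int[leb]_(x in _) _)%E in I_fin.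
have I0 : (0 <= I)%E by apply: integral_ge0 => x _; rewrite lee_fin powR_ge0.
have If : I = (fine I)%:E by rewrite fineK// ge0_fin_numE.
have le n : (\int[leb]_(x in `]0%R, 1%R[)
    (dist2 beta (representative a) (partial_sum a n) x)%:E <=
    (2 * tau n ^+ 2 * fine I)%:E)%E.
  have ct : 0 <= 2 * tau n ^+ 2 by rewrite mulr_ge0// sqr_ge0.
  have mp : measurable_fun (`]0, 1[ : set R) (fun x => (x `^ (2 * edge_exponent + beta))%:E).
    apply/measurable_EFinP; apply: open_continuous_measurable_fun.
      exact: interval_open.
    move=> x; rewrite inE/= in_itv/= => /andP[x0 _].
    by eapply is_derive_cvg; der; reflexivity.
  rewrite EFinM -If -ge0_integralZl//; last first.
    by move=> x _; rewrite lee_fin powR_ge0.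
  apply: ge0_le_integral => //.
  - by move=> x _; rewrite lee_fin dist2_ge0.
  - by apply: dist2_measurable; [exact: representative_continuous|exact: partial_sum_continuous].
  - exact: measurable_funeM.
  move=> x /=; rewrite in_itv/= => /andP[x0 x1]; rewrite -EFinM lee_fin.
  rewrite /dist2 normc_sqr !raddfB/= Re_partial_sum// Im_partial_sum// -!mulrBr.
  have T1 := profile_series_tail n x (wRe a) sa pB.
  have T2 := profile_series_tail n x (wIm a) sa pB.
  rewrite -/m -/(tau n) in T1 T2.
  have -> : x `^ (2 * edge_exponent + beta) = (x `^ edge_exponent) ^+ 2 * x `^ beta.
    rewrite powRD ?(gt_eqF x0) ?implybT//; congr (_ * _).
    by rewrite mulrC powRrM (powR_mulrn _ (powR_ge0 _ _)).
  have sq (u t : R) : `|u| <= t -> u ^+ 2 <= t ^+ 2.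
    move=> ut; rewrite -(real_normK (num_real u)) lerXn2r ?nnegrE//.
    exact: le_trans ut.
  move: (sq _ _ T1) (sq _ _ T2); move: (tau n) (x `^ _) (x `^ _) (powR_ge0 x beta) => t p b b0.
  move: (_ - _) (_ - _) => u v ut vt.
  have pb : 0 <= p ^+ 2 * b by rewrite mulr_ge0// sqr_ge0.
  have -> : ((p * v) ^+ 2 + (p * u) ^+ 2) * b = (p ^+ 2 * b) * (u ^+ 2 + v ^+ 2) by ring.
  by rewrite mulrC ler_wpM2r//; lra.
rewrite /is_L2_sum.
apply: (@squeeze_cvge _ _ _ _ (fun=> 0%E) _ (fun n => (2 * tau n ^+ 2 * fine I)%:E)).
- apply: nearW => n; apply/andP; split; last exact: le.
  apply: integral_ge0 => x _.
  by rewrite lee_fin; exact: (dist2_ge0 beta (representative a) (partial_sum a n) x).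
- exact: cvg_cst.
- apply: cvg_EFin; first exact: nearW.
  rewrite [X in _ --> X](_ : 0 = 2 * (0 * 0) * fine I); last by ring.
  apply: cvgM; last exact: cvg_cst.
  by apply: cvgM; [exact: cvg_cst|exact: cvgM].
Qed.

(** The representative obtained by choice is a continuous sum of the series in
    the weighted L2 space, and such a sum is unique. *)
Lemma continuous_representativeE a x : edge_summable a -> 0 < x < 1 ->
  continuous_representative alpha beta mu a x = representative a x.
Proof.
move=> sa x01; rewrite /continuous_representative.
set S := [set f | _].
have Srep : S (representative a).
  split; last exact: representative_L2_sum.
  exact/within_continuous01/representative_continuous.
have [/within_continuous01 cf L2f] : S (xget (fun=> 0) S) by exact: (xgetPex _ (ex_intro _ _ Srep)).
apply: (L2_limit_unique (beta := beta) cf (representative_continuous sa)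
  (partial_sum_continuous a) L2f _ x01).
exact: representative_L2_sum.
Qed.

Definition edge_sum (part : R[i] -> R) a : R :=
  limn (series (fun k => mode_weight k * part (a k))).

Lemma weighted_limit_representative a : edge_summable a ->
  weighted_limit0 (- edge_exponent) (continuous_representative alpha beta mu a) =
  (besselG nn 0)%:C%C *
    (edge_sum (@complex.Re R) a +i* edge_sum (@complex.Im R) a)%C.
Proof.
move=> sa; have [B B0 pB] := profile_bounded.
have GB : `|besselG nn 0| <= B.
  have := pB 0%N 0; rewrite /profile powR0 ?gt_eqF ?kappa_gt0//.
  by rewrite mulr0 expr0n mulr0.
have lim_part (d : nat -> R) : (forall k, `|d k| <= mode_weight k * normc (a k)) ->
    profile_series d x @[x --> 0^'+] --> besselG nn 0 * limn (series d).
  move=> dm.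
  have cd : cvgn (series d) by exact: is_cvg_series_dominated dm sa.
  have -> : besselG nn 0 * limn (series d) = limn (series (fun k => d k * besselG nn 0)).
    apply/esym/cvg_lim => //.
    rewrite (_ : series _ = fun n => besselG nn 0 * series d n).
      by apply: cvgM => //; exact: cvg_cst.
    by apply/funext => n; rewrite /series/= -mulr_suml mulrC.
  apply: (@profile_series_cvg _ _ d _ (fun=> besselG nn 0) B dm sa pB) => // k.
  exact: profile_cvg0.
rewrite /weighted_limit0; apply: (@cvg_lim R[i]^o); first exact: norm_hausdorff.
have near01 : \forall x \near (0 : R)^'+, 0 < x < 1.
  near=> x; apply/andP; split; near: x; [exact: nbhs_right_gt|exact: nbhs_right_lt].
have cancel x : 0 < x -> x `^ (- edge_exponent) * x `^ edge_exponent = 1.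
  by move=> x0; rewrite -powRD ?(gt_eqF x0) ?implybT// addNr powRr0.
apply: cvg_complex.
- rewrite (_ : complex.Re _ = besselG nn 0 * edge_sum (@complex.Re R) a); last first.
    by rewrite /= mul0r subr0.
  apply: cvg_trans (lim_part _ (wRe a)); apply: near_eq_cvg.
  apply: filterS near01 => x x01; rewrite continuous_representativeE//.
  by case/andP: x01 => x0 _; rewrite /= mul0r subr0 mulrA cancel// mul1r.
- rewrite (_ : complex.Im _ = besselG nn 0 * edge_sum (@complex.Im R) a); last first.
    by rewrite /= mul0r addr0.
  apply: cvg_trans (lim_part _ (wIm a)); apply: near_eq_cvg.
  apply: filterS near01 => x x01; rewrite continuous_representativeE//.
  by case/andP: x01 => x0 _; rewrite /= mul0r addr0 mulrA cancel// mul1r.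
Unshelve. all: by end_near. Qed.

Lemma observation_normc : exists2 K : R, 0 < K & forall w : coefs R * coefs R,
  edge_summable w.1 -> normc (observation alpha beta mu w) ^+ 2 =
    K * (edge_sum (@complex.Re R) w.1 ^+ 2 + edge_sum (@complex.Im R) w.1 ^+ 2).
Proof.
have G0 : 0 < besselG nn 0 by rewrite besselG0 invr_gt0 Gamma_gt0// lerDr nu_ge0.
have kap0 := kappa_gt0.
pose c : R := if nn == 0 then 1 else Num.sqrt (Delta alpha beta mu).
have c0 : 0 < c.
  rewrite /c; case: eqP => // /eqP nn0; rewrite lt_neqAle sqrtr_ge0 andbT eq_sym.
  by move: nn0; apply: contra => /eqP D0; rewrite /nu D0 mul0r.
exists ((c * besselG nn 0) ^+ 2) => [|w sw]; first by rewrite exprn_gt0// mulr_gt0.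
have -> : observation alpha beta mu w = (c * besselG nn 0)%:C%C *
    (edge_sum (@complex.Re R) w.1 +i* edge_sum (@complex.Im R) w.1)%C.
  have W := weighted_limit_representative sw.
  have E1 : nn = 0 -> - sigma alpha beta = - edge_exponent.
    by rewrite /edge_exponent => ->; rewrite mulr0 addr0.
  have E2 : - sigma alpha beta - Num.sqrt (Delta alpha beta mu) / 2 = - edge_exponent.
    rewrite /edge_exponent /nu; move: (Num.sqrt _) (sigma _ _) kap kap0 => q r t t0.
    by field; rewrite gt_eqF.
  rewrite rmorphM -mulrA -W /observation /c E2; case: eqP => [/E1 ->|_] //.
  by rewrite mul1r.
by rewrite normc_sqr /= !mul0r subr0 addr0 !exprMn mulrDr.
Qed.

End Observation.

(** * Observability of infinite trigonometric series *)

Section TimeIntegral.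
Variable R : realType.
Implicit Types (w A B m : nat -> R) (L T t : R) (n k : nat).
Local Notation mu := (@lebesgue_measure R).
Local Notation itg a b f := (\int[mu]_(x in `[a, b]) f x).

Lemma cvg_series_bounded_ge0 (u : nat -> R) (M : R) :
  (forall k, 0 <= u k) -> (forall n, series u n <= M) -> cvgn (series u).
Proof.
move=> u0 uM; apply: nondecreasing_is_cvgn; first exact: nondecreasing_series.
by exists M => _ [n _ <-].
Qed.

Lemma cvg_series_inv_odd_sqr : cvgn (series (fun k => inv_odd R k ^+ 2)).
Proof.
apply: (@cvg_series_bounded_ge0 _ 2) => [k|n]; first exact: sqr_ge0.
apply: (@le_trans _ _ (2 * (1 - inv_odd R n))); last first.
  by have := @inv_odd_ge0 R n; lra.
elim: n => [|n IH].
  by rewrite /series/= big_geq// /inv_odd mulr0 add0r invr1 subrr mulr0.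
rewrite /series/= big_nat_recr//=; apply: (le_trans (lerD IH (lexx _))).
suff : inv_odd R n ^+ 2 <= 2 * (inv_odd R n - inv_odd R n.+1) by lra.
rewrite /inv_odd (_ : n.+1%:R = n%:R + 1 :> R); last by rewrite natr1.
have n0 : 0 <= n%:R :> R by [].
move: (n%:R : R) n0 => x x0.
have p1 : 0 < 2 * x + 1 by lra.
have p2 : 0 < 2 * x + 3 by lra.
have -> : 2 * ((2 * x + 1)^-1 - (2 * (x + 1) + 1)^-1) = 4 / ((2 * x + 1) * (2 * x + 3)).
  by field; rewrite !gt_eqF//; lra.
by rewrite exprVn -[leLHS]mul1r ler_pdivrMr ?exprn_gt0// mulrAC ler_pdivlMr ?mulr_gt0//; nra.
Qed.

Lemma uniform_gap_scale (c g : R) w : 0 < c -> uniform_gap g w ->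
  uniform_gap (c * g) (fun k => c * w k).
Proof.
move=> c0 [wS w0]; split => [k|]; first by rewrite -mulrBr ler_pM2l.
by rewrite mulrCA ler_pM2l.
Qed.

(** A translation in time rotates every pair [(A k, B k)], which leaves [coef2]
    unchanged. *)
Lemma observable_shift L w : 0 <= L -> observable L w -> exists2 c : R, 0 < c &
  forall A B n, c * coef2 A B n <= itg 0 (2 * L) (fun t => trigsum w A B n t ^+ 2).
Proof.
move=> L0 [c c0 obs]; exists c => // A B n.
pose A' k := A k * cos (w k * L) + B k * sin (w k * L).
pose B' k := B k * cos (w k * L) - A k * sin (w k * L).
have -> : coef2 A B n = coef2 A' B' n.
  apply: eq_bigr => k _; rewrite /A' /B'.
  have := cos2Dsin2 (w k * L); move: (cos _) (sin _) => x y xy.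
  have -> : (A k * x + B k * y) ^+ 2 + (B k * x - A k * y) ^+ 2 =
    (A k ^+ 2 + B k ^+ 2) * (x ^+ 2 + y ^+ 2) by ring.
  by rewrite xy mulr1.
apply: (le_trans (obs _ _ _)).
have E t : trigsum w A' B' n t = trigsum w A B n (t + L).
  apply: eq_bigr => k _; rewrite mulrDr cosD sinD /A' /B'; ring.
under eq_Rintegral do rewrite E.
rewrite (@itg_shift _ (fun t => trigsum w A B n t ^+ 2) L); last 2 first.
- by rewrite ge0_cp.
- exact: continuous_trigsum_sqr.
by rewrite addNr mulr2n mulrDl mul1r.
Qed.

Definition trigseries w A B t : R :=
  limn (series (fun k => A k * cos (w k * t) + B k * sin (w k * t))).

Lemma trig_term_le (a b x : R) : `|a * cos x + b * sin x| <= `|a| + `|b|.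
Proof.
apply: (le_trans (ler_normD _ _)); rewrite !normrM.
by apply: lerD; rewrite ler_piMr// ?cos_max ?sin_max.
Qed.

Section Limit.
Variables (w A B m : nat -> R).
Hypotheses (ABm : forall k, `|A k| + `|B k| <= m k) (cm : cvgn (series m)).

Let term_le t k : `|A k * cos (w k * t) + B k * sin (w k * t)| <= m k.
Proof. exact: le_trans (trig_term_le _ _ _) (ABm k). Qed.

Lemma continuous_trigseries : continuous (trigseries w A B).
Proof.
move=> t; apply: (@tannery _ _ (nbhs t) _ _ _ m) => // k.
have : continuous (fun t : R => A k * cos (w k * t) + B k * sin (w k * t)) by cont.
exact.
Qed.

(** The partial sums converge uniformly, hence their energies converge. *)
Lemma trigseries_observed (c T : R) : 0 < c -> 0 <= T ->
  (forall n, c * coef2 A B n <= itg 0 T (fun t => trigsum w A B n t ^+ 2)) ->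
  forall n, c * coef2 A B n <= itg 0 T (fun t => trigseries w A B t ^+ 2).
Proof.
move=> c0 T0 obs n; set y := trigseries w A B; set M := limn (series m).
have cy : continuous y by exact: continuous_trigseries.
pose tau N := M - series m N.
have m0 k : 0 <= m k by apply: le_trans (ABm k); rewrite addr_ge0.
have tail N t : `|y t - trigsum w A B N t| <= tau N.
  have := @series_tail_le _ _ _ N (term_le t) cm.
  by rewrite /series/= big_mkord.
have yM t : `|y t| <= M.
  by have := tail 0%N t; rewrite /tau /trigsum big_ord0 /series/= big_geq// !subr0.
have tau_ge0 N : 0 <= tau N by exact: le_trans (tail N 0).
have tauM N : tau N <= M by rewrite gerBl /series/= sumr_ge0.
(* a uniform error [q] perturbs the squares by at most [3 r q] *)
have sqb (u v q r : R) : `|u - v| <= q -> `|u| <= r -> q <= r -> 0 <= q ->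
    v ^+ 2 <= u ^+ 2 + 3 * r * q.
  rewrite !ler_norml => /andP[h1 h2] /andP[h3 h4] qr q0.
  have h5 : 0 <= (r - u) * (q - (u - v)) by rewrite mulr_ge0// subr_ge0.
  have h6 : 0 <= (r + u) * (q + (u - v)).
    by rewrite mulr_ge0// -lerBlDl sub0r// lerNl.
  by nra.
have key N : (n <= N)%N -> c * coef2 A B n <=
    itg 0 T (fun t => y t ^+ 2) + 3 * M * T * tau N.
  move=> nN; apply: (@le_trans _ _ (c * coef2 A B N)).
    rewrite ler_pM2l// /coef2 -!(big_mkord xpredT (fun k => A k ^+ 2 + B k ^+ 2)).
    rewrite [leRHS](big_cat_nat (n := n))//= lerDl sumr_ge0// => k _.
    by rewrite addr_ge0// sqr_ge0.
  apply: (le_trans (obs N)).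
  apply: (@le_trans _ _ (itg 0 T (fun t => y t ^+ 2 + 3 * M * tau N))).
    apply: itg_le; [exact: continuous_trigsum_sqr|by cont|move=> t _].
    exact: sqb (tail N t) (yM t) (tauM N) (tau_ge0 N).
  rewrite itgD; [|by cont|by cont].
  by rewrite (itg_const _ T0) lerD2l; lra.
have lim : (fun N => itg 0 T (fun t => y t ^+ 2) + 3 * M * T * tau N) @ \oo -->
    itg 0 T (fun t => y t ^+ 2).
  rewrite -[X in _ --> X]addr0; apply: cvgD; first exact: cvg_cst.
  rewrite [X in _ --> X](_ : 0 = 3 * M * T * (M - M)); last by rewrite subrr mulr0.
  by apply: cvgM; [exact: cvg_cst|apply: cvgB => //; exact: cvg_cst].
rewrite -(cvg_lim _ lim)//; apply: limr_ge; first exact: cvgP lim.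
by near=> N; apply: key; near: N; exact: nbhs_infty_ge.
Unshelve. all: by end_near. Qed.

End Limit.
End TimeIntegral.

(** * Data of finite energy *)

Section EnergySpace.
Variables (R : realType) (alpha beta mu : R).
Hypothesis alpha2 : alpha < 2.
Local Notation normc := (@ComplexField.Normc.normc R).
Local Notation nn := (nu alpha beta mu).
Local Notation gam := (gamma alpha beta mu).
Local Notation W := (mode_weight alpha beta mu).
Implicit Types (k n : nat) (a : coefs R).

Let gam0 k : 0 < gam k. Proof. exact: gamma_gt0. Qed.

Lemma gamma_uniform_gap : exists2 g : R, 0 < g & uniform_gap g gam.
Proof.
have kap0 := kappa_gt0 alpha2.
have [d d0 zd] := bessel_zero_uniform_gap (nu_ge0 beta mu alpha2).
exists (kappa alpha * d); first exact: mulr_gt0.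
have -> : gam = fun k => kappa alpha * bessel_zero nn k.
  by apply/funext => k; rewrite gammaE.
exact: uniform_gap_scale.
Qed.

(** The frequencies [kappa j_k] have asymptotic gap [kappa pi / M] for each
    [M > 1]. As [1 < kappa L], one can choose [M > 1] and a shorter time
    [L1 < L] with [M < kappa L1]. *)
Lemma gamma_observable L : 1 < kappa alpha * L -> observable L gam.
Proof.
move=> kL; have kap0 := kappa_gt0 alpha2; have pi0 := pi_gt0 R.
have [g g0 wg] := gamma_uniform_gap.
move: (kappa alpha) kL kap0 (fun k => gammaE beta mu alpha2 k) => q kL q0 gE.
(* [L1] lies halfway between [1 / kappa] and [L], [M] between 1 and [kappa L1] *)
pose L1 := (L + q^-1) / 2.
have qi : q * q^-1 = 1 by rewrite mulfV// gt_eqF.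
have qi0 : 0 < q^-1 by rewrite invr_gt0.
have L0 : q^-1 < L by rewrite -(ltr_pM2l q0) qi.
have qL1 : 1 < q * L1 by rewrite /L1; nra.
pose M := (1 + q * L1) / 2.
have M1 : 1 < M by rewrite /M; lra.
have M0 : 0 < M by exact: lt_trans M1.
have ML : M < q * L1 by rewrite /M; lra.
have [N zN] := bessel_zero_asymptotic_gap (nu_ge0 beta mu alpha2) M1.
apply: (@observable_asymptotic_gap R N L1 L g (q * (pi / M))) => //.
- by rewrite /L1; lra.
- by rewrite /L1; lra.
- by rewrite mulr_gt0// divr_gt0.
- rewrite (_ : L1 * (q * (pi / M)) = pi * (q * L1) / M); last by ring.
  by rewrite ltr_pdivlMr// ltr_pM2l.
rewrite (_ : (fun k => _) = fun k => q * bessel_zero nn (N + k)).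
  exact: uniform_gap_scale.
by apply/funext => k; rewrite gE.
Qed.

Lemma in_H_summable (s : R) a : in_H alpha beta mu s a ->
  cvgn (series (fun k => gam k `^ (2 * s) * normc (a k) ^+ 2)).
Proof.
move=> Ha; pose u k := gam k `^ (2 * s) * normc (a k) ^+ 2.
have u0 k : 0 <= u k by rewrite mulr_ge0 ?powR_ge0// sqr_ge0.
have HE : Hnorm2 alpha beta mu s a = (\sum_(0 <= k <oo) (u k)%:E)%E.
  by apply: eq_eseriesr => k _; rewrite /u lambda_powR.
rewrite /in_H HE in Ha.
have S0 : (0 <= \sum_(0 <= k <oo) (u k)%:E)%E by apply: nneseries_ge0 => k _ _; rewrite lee_fin.
apply: (@cvg_series_bounded_ge0 _ _ (fine (\sum_(0 <= k <oo) (u k)%:E)%E)) => // n.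
rewrite -lee_fin fineK ?ge0_fin_numE// /series/= -sumEFin.
apply: (@nneseries_lim_ge _ (fun k => (u k)%:E) xpredT 0%N n) => k _ _.
by rewrite lee_fin.
Qed.

Lemma cvg_series_gamma_invsqr : cvgn (series (fun k => (gam k)^-1 ^+ 2)).
Proof.
have [g g0 wg] := gamma_uniform_gap.
apply: (@series_le_cvg _ _ (fun k => (2 / g) ^+ 2 * inv_odd R k ^+ 2)) => [k|k|k|].
- exact: sqr_ge0.
- by rewrite mulr_ge0// sqr_ge0.
- rewrite -exprMn lerXn2r ?nnegrE ?invr_ge0 ?(ltW (gam0 k))//.
    by rewrite mulr_ge0 ?inv_odd_ge0// divr_ge0// ltW.
  have := uniform_gap_add k k wg; rewrite -mulr2n -(mulr_natl (gam k)) => h.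
  have o0 : 0 < 2 * k%:R + 1 :> R by rewrite ltr_wpDl// mulr_ge0.
  have -> : 2 / g * inv_odd R k = (g / 2 * (2 * k%:R + 1))^-1.
    by rewrite /inv_odd [in RHS]invfM invf_div.
  rewrite lef_pV2 ?posrE ?mulr_gt0 ?divr_gt0//.
  move: h; rewrite -natr1 addnn -mul2n natrM; move: (gam k) => x; lra.
- rewrite (_ : series _ = fun n => (2 / g) ^+ 2 * series (fun k => inv_odd R k ^+ 2) n).
    by apply: is_cvgM; [exact: is_cvg_cst|exact: cvg_series_inv_odd_sqr].
  by apply/funext => n; rewrite /series/= mulr_sumr.
Qed.

(** [W k * |a_k|] is the product of [W k * gam k * |a_k|] and [(gam k)^-1], both
    square summable. The additional factor [gam k] is the order of smoothness
    that the domain [X_1] has over [X]. *)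
Lemma weighted_summable (r : nat -> R) (C : R) a : 0 < C -> (forall k, 0 <= r k) ->
  cvgn (series (fun k => r k * normc (a k) ^+ 2)) ->
  (forall k, W k ^+ 2 * gam k ^+ 2 <= C * r k) ->
  edge_summable alpha beta mu a.
Proof.
move=> C0 r0 cr Wr; rewrite /edge_summable.
apply: (@series_le_cvg _ _ (fun k => C * (r k * normc (a k) ^+ 2) + (gam k)^-1 ^+ 2)).
- by move=> k; rewrite mulr_ge0 ?mode_weight_ge0 ?normc_ge0.
- by move=> k; rewrite addr_ge0 ?sqr_ge0// mulr_ge0 ?(ltW C0)// mulr_ge0// sqr_ge0.
- move=> k; have gk := gam0 k; pose x := W k * gam k * normc (a k).
  have -> : W k * normc (a k) = x * (gam k)^-1 by rewrite /x; field; rewrite gt_eqF.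
  have x2 : x ^+ 2 <= C * (r k * normc (a k) ^+ 2).
    by rewrite /x exprMn [(W k * _) ^+ 2]exprMn (mulrA C) ler_wpM2r ?sqr_ge0.
  apply: (@le_trans _ _ (x ^+ 2 + (gam k)^-1 ^+ 2)); last by rewrite lerD2r.
  by have := sqr_ge0 (x - (gam k)^-1); have := sqr_ge0 x; have := sqr_ge0 (gam k)^-1; nra.
- rewrite (_ : series _ = fun n => C * series (fun k => r k * normc (a k) ^+ 2) n +
      series (fun k => (gam k)^-1 ^+ 2) n).
    apply: is_cvgD; last exact: cvg_series_gamma_invsqr.
    by apply: is_cvgM => //; exact: is_cvg_cst.
  by apply/funext => n; rewrite /series/= big_split/= mulr_sumr.
Qed.

Let gamD k (p q : R) : gam k `^ (p + q) = gam k `^ p * gam k `^ q.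
Proof. by rewrite powRD// (gt_eqF (gam0 k)) implybT. Qed.

Let gam2 k : gam k `^ 2 = gam k ^+ 2.
Proof. by rewrite -powR_mulrn// ltW. Qed.

(** The coefficient of [sin (gam k * t)] in the first component of the evolution
    ([evolution_fst]). *)
Definition velocity (w : coefs R * coefs R) : coefs R :=
  fun k => w.2 k * ((gam k)^-1)%:C%C.

Lemma normc_mul_real (x : R[i]) (r : R) : normc (x * r%:C%C) = normc x * `|r|.
Proof. by rewrite ComplexField.Normc.normcM /= expr0n/= addr0 sqrtr_sqr. Qed.

Lemma normc_velocity w k : normc (velocity w k) = normc (w.2 k) / gam k.
Proof. by rewrite normc_mul_real gtr0_norm// invr_gt0. Qed.

Lemma in_X1_edge_summable w : in_X1 alpha beta mu w ->
  edge_summable alpha beta mu w.1 /\ edge_summable alpha beta mu (velocity w).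
Proof.
move=> [/in_H_summable H1 /in_H_summable H2].
have [c [C [c0 C0 cC]]] := mode_weight_bounds beta mu alpha2.
split.
- apply: (weighted_summable C0 _ H1) => k; first exact: powR_ge0.
  have -> : 2 * (nn + 3 / 2) = (2 * nn + 1) + 2 by field.
  rewrite gamD gam2 mulrA ler_wpM2r ?sqr_ge0//.
  by have /andP[] := cC k.
- apply: (weighted_summable (r := fun k => gam k `^ (2 * (nn + 1 / 2)) * gam k ^+ 2) C0).
  + by move=> k; rewrite mulr_ge0 ?powR_ge0 ?sqr_ge0.
  + have E k : gam k `^ (2 * (nn + 1 / 2)) * gam k ^+ 2 * normc (velocity w k) ^+ 2 =
        gam k `^ (2 * (nn + 1 / 2)) * normc (w.2 k) ^+ 2.
      by rewrite normc_velocity; field; rewrite gt_eqF.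
    by under eq_fun do rewrite E.
  move=> k; have -> : 2 * (nn + 1 / 2) = 2 * nn + 1 by field.
  by rewrite mulrA ler_wpM2r ?sqr_ge0//; have /andP[] := cC k.
Qed.

(** Dividing the velocity by the frequency gives both components of [X] the same
    weight [gam k `^ (2 nu + 1)], which is that of [mode_weight k ^+ 2]. *)
Lemma Xnorm2_le w (M c : R) : 0 < c ->
  (forall n, c * \sum_(0 <= k < n) gam k `^ (2 * nn + 1) *
     (normc (w.1 k) ^+ 2 + normc (velocity w k) ^+ 2) <= M) ->
  (c%:E * Xnorm2 alpha beta mu w <= M%:E)%E.
Proof.
move=> c0 hM.
pose u k := gam k `^ (2 * nn + 1) * (normc (w.1 k) ^+ 2 + normc (velocity w k) ^+ 2).
have u0 k : 0 <= u k by rewrite mulr_ge0 ?powR_ge0// addr_ge0// sqr_ge0.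
have -> : Xnorm2 alpha beta mu w = (\sum_(0 <= k <oo) (u k)%:E)%E.
  rewrite /Xnorm2 /Hnorm2 -nneseriesD; first last.
  - by move=> k _ _; rewrite lee_fin mulr_ge0 ?powR_ge0 ?sqr_ge0.
  - by move=> k _ _; rewrite lee_fin mulr_ge0 ?powR_ge0 ?sqr_ge0.
  apply: eq_eseriesr => k _; rewrite -EFinD; congr (_%:E).
  rewrite !lambda_powR// /u normc_velocity.
  have -> : 2 * (nn + 1 / 2) = 2 * nn + 1 by field.
  have -> : 2 * nn + 1 = 2 * (nn - 1 / 2) + 2 by field.
  by rewrite gamD gam2; field; rewrite gt_eqF.
have -> : (M%:E = c%:E * (M / c)%:E)%E by rewrite -EFinM mulrCA mulfV ?mulr1// gt_eqF.
apply: lee_wpmul2l; first by rewrite lee_fin ltW.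
apply: lime_le.
  by apply: is_cvg_nneseries => k _ _; rewrite lee_fin.
apply: nearW => n; rewrite sumEFin lee_fin ler_pdivlMr// mulrC; exact: hM.
Qed.

Lemma evolution_fst w t k : (evolution alpha beta mu t w).1 k =
  w.1 k * (cos (gam k * t))%:C%C + velocity w k * (sin (gam k * t))%:C%C.
Proof. by rewrite /evolution/= /velocity -[in RHS]mulrA -rmorphM. Qed.

Lemma evolution_normc_le w t k :
  normc ((evolution alpha beta mu t w).1 k) <= normc (w.1 k) + normc (velocity w k).
Proof.
rewrite evolution_fst; apply: (le_trans (@le_normcD R _ _) (lerD _ _)).
  by rewrite normc_mul_real; apply: ler_piMr (normc_ge0 _) (cos_max _).
by rewrite normc_mul_real; apply: ler_piMr (normc_ge0 _) (sin_max _).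
Qed.

(** Taken for the real and for the imaginary part, this writes the observed
    signal as two real trigonometric series with the frequencies [gam k]. *)
Lemma edge_sum_evolution w (part : R[i] -> R) t :
  (forall x (r : R), part (x * r%:C%C) = part x * r) ->
  {morph part : x y / x + y} ->
  edge_sum alpha beta mu part (evolution alpha beta mu t w).1 =
  trigseries gam (fun k => W k * part (w.1 k)) (fun k => W k * part (velocity w k)) t.
Proof.
move=> partM partD; congr (limn (series _)); apply/funext => k.
by rewrite evolution_fst partD !partM mulrDr !mulrA.
Qed.

End EnergySpace.

(** * The observability inequality *)

Theorem proposition10 (R : realType) (alpha beta mu T : R)
  (halpha0 : 0 <= alpha) (halpha2 : alpha < 2)
  (hDelta : 0 <= Delta alpha beta mu)
  (hT : 4 / (2 - alpha) < T) :
  exists2 c : R, 0 < c &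
    forall w : coefs R * coefs R, in_X1 alpha beta mu w ->
      (c%:E * Xnorm2 alpha beta mu w <=
       \int[lebesgue_measure]_(t in `[0%R, T])
         ((ComplexField.Normc.normc (observation alpha beta mu
                    (evolution alpha beta mu t w))) ^+ 2)%:E)%E.
Proof.
pose gam := gamma alpha beta mu; pose W := mode_weight alpha beta mu.
have a2 : 0 < 2 - alpha by rewrite subr_gt0.
have T0 : 0 < T by apply: lt_trans hT; rewrite divr_gt0.
have kT : 1 < kappa alpha * (T / 2).
  by move: hT; rewrite ltr_pdivrMr// /kappa => hT; nra.
have T20 : 0 <= T / 2 by rewrite divr_ge0// ltW.
have [c c0 obs] := observable_shift T20 (gamma_observable beta mu halpha2 kT).
have TT : 2 * (T / 2) = T by field.
have [K K0 obsE] := observation_normc beta mu halpha2.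
have [cW [CW [cW0 _ WcC]]] := mode_weight_bounds beta mu halpha2.
(* [K] comes from the trace, [c] from the trigonometric sums, [cW] from the
   comparison of the weights *)
exists (K * c * cW) => [|w wX1]; first by rewrite !mulr_gt0.
have [s1 s2] := in_X1_edge_summable halpha2 wX1.
pose v := velocity alpha beta mu w.
pose normc : R[i] -> R := @ComplexField.Normc.normc R.
pose m k := W k * normc (w.1 k) + W k * normc (v k).
have cm : cvgn (series m).
  have -> : series m = fun n => series (fun k => W k * normc (w.1 k)) n +
      series (fun k => W k * normc (v k)) n.
    by apply/funext => n; rewrite /series/= big_split.
  exact: is_cvgD.
have W0 k : 0 <= W k by exact: mode_weight_ge0.
have evol_summable t : edge_summable alpha beta mu (evolution alpha beta mu t w).1.
  apply: (is_cvg_series_dominated (m := m)) => // k.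
  have -> : m k = W k * (normc (w.1 k) + normc (v k)) by rewrite mulrDr.
  rewrite ger0_norm; last exact: mulr_ge0 (W0 k) (normc_ge0 _).
  by apply: (ler_wpM2l (W0 k)); exact: evolution_normc_le.
pose y part t : R := trigseries gam (fun k => W k * part (w.1 k)) (fun k => W k * part (v k)) t.
(* [part] is the real or the imaginary part *)
have part_observed (part : R[i] -> R) : (forall x, `|part x| <= normc x) ->
    continuous (y part) /\
    forall n, c * coef2 (fun k => W k * part (w.1 k)) (fun k => W k * part (v k)) n <=
    \int[lebesgue_measure]_(t in `[0, T]) y part t ^+ 2.
  move=> part_le.
  have ABm k : `|W k * part (w.1 k)| + `|W k * part (v k)| <= m k.
    have le (r : R) z : 0 <= r -> `|r * part z| <= r * normc z.
      by move=> r0; rewrite normrM ger0_norm// ler_wpM2l.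
    exact: lerD (le _ _ (W0 k)) (le _ _ (W0 k)).
  split; first exact: continuous_trigseries ABm cm.
  apply: (trigseries_observed ABm cm c0 (ltW T0)) => n.
  by have := obs (fun k => W k * part (w.1 k)) (fun k => W k * part (v k)) n; rewrite TT.
have [cRe oRe] := part_observed _ (@Re_le_normc R).
have [cIm oIm] := part_observed _ (@Im_le_normc R).
set Y1 := y _ in cRe oRe; set Y2 := y _ in cIm oIm.
have cY : continuous (fun t => K * (Y1 t ^+ 2 + Y2 t ^+ 2)) by cont.
have -> : (\int[lebesgue_measure]_(t in `[0%R, T])
    ((normc (observation alpha beta mu (evolution alpha beta mu t w))) ^+ 2)%:E)%E =
    (\int[lebesgue_measure]_(t in `[0, T]) (K * (Y1 t ^+ 2 + Y2 t ^+ 2)))%:E.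
  rewrite /Rintegral fineK; last first.
    by apply: integrable_fin_num => //; exact: continuous_integrable.
  apply: eq_integral => t _; rewrite /normc obsE//.
  have -> : edge_sum alpha beta mu (@complex.Re R) (evolution alpha beta mu t w).1 = Y1 t.
    by apply: edge_sum_evolution => [x r|x z]; [exact: Re_mul_real|exact: raddfD].
  have -> // : edge_sum alpha beta mu (@complex.Im R) (evolution alpha beta mu t w).1 = Y2 t.
  by apply: edge_sum_evolution => [x r|x z]; [exact: Im_mul_real|exact: raddfD].
rewrite itgZ; [|by cont]; rewrite itgD; [|by cont|by cont].
set J1 := Rintegral _ _ _ in oRe *; set J2 := Rintegral _ _ _ in oIm *.
have -> : (K * c * cW)%:E = ((K * c)%:E * cW%:E)%E by rewrite EFinM.
rewrite -muleA.
have -> : (K * (J1 + J2))%:E = ((K * c)%:E * ((J1 + J2) / c)%:E)%E.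
  by rewrite -EFinM; congr (_%:E); field; rewrite gt_eqF.
apply: lee_wpmul2l; first by rewrite lee_fin (ltW (mulr_gt0 K0 c0)).
apply: Xnorm2_le => // n; rewrite ler_pdivlMr//.
apply: le_trans (lerD (oRe n) (oIm n)).
rewrite -mulrDr mulrC ler_pM2l// /coef2 -big_split/= mulr_sumr big_mkord.
apply: ler_sum => k _; have /andP[Wk _] := WcC k.
rewrite mulrA; apply: le_trans (_ : W k ^+ 2 * (normc (w.1 k) ^+ 2 + normc (v k) ^+ 2) <= _).
  by rewrite ler_wpM2r// addr_ge0 ?sqr_ge0.
by rewrite /normc !normc_sqr; lra.
Qed.
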